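(* Let $n,k,t\ge0$ be integers with $t\ge1$ and $n-kt>t$. Then $$\Delta_{n,t}^{[k]}\simeq\bigvee_{\substack{1\le j\le k\\ jt\le m\le jt+t}}\ \bigvee_{\alpha\ge0}\ \bigvee_{N_{n,k}(m,j,\alpha)}\Sigma^\alpha\left(\Delta_{m,t}^{[j]}\right),$$ where the innermost wedge is of $N_{n,k}(m,j,\alpha)$ copies, and $N_{n,k}(m,j,\alpha)$ is the number of directed paths in the labelled directed graph $G_{n,t}^{[k]}$ from $(n,k)$ to $(m,j)$ with label sum $\alpha$.
   Context: Complexes: Let $K$ be a field and $[m]=\{1,\dots,m\}$. The $t$-path ideal $I_{m,t}\subseteq K[x_1,\dots,x_m]$ of the path graph on $[m]$ is generated by $x_ix_{i+1}\cdots x_{i+t-1}$, $1\le i\le m-t+1$. For $j\ge1$, the squarefree power $I_{m,t}^{[j]}$ is generated by products of $j$ of these generators with pairwise disjoint supports. Its Stanley--Reisner complex $\Sigma_{m,t}^{[j]}$ consists of the $F\subseteq[m]$ with $\prod_{i\in F}x_i\notin I_{m,t}^{[j]}$, and $\Delta_{m,t}^{[j]}=\{[m]\setminus F: F\subseteq[m],\ F\notin\Sigma_{m,t}^{[j]}\}$ is its Alexander dual. For $j=0$, $\Delta_{m,t}^{[0]}$ is the full simplex on $[m]$. When $m=jt$, $j\geq 1$, $\Delta_{m,t}^{[j]}$ is the complex with no vertices, denoted $\emptyset$. $\Sigma$ applied to a complex is suspension (join with two disjoint points), with $\Sigma(\emptyset)=S^0$, and $\Sigma^\alpha$ its $\alpha$-fold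 iterate; $\vee$ is the wedge sum; an empty wedge is a point; $\simeq$ is homotopy equivalence. Graph: $G_{n,t}^{[k]}$ is the directed graph on the vertex set $\{(m,j)\in\mathbb N^2: 0\le j\le k,\ jt\le m\le n-(k-j)t\}$ (with $0\in\mathbb N$), with, for every vertex $(m,j)$ such that $j>0$ and $m\ge jt+t+1$, three labelled directed edges: $(m,j)\to(m-t,j-1)$ with label $0$; $(m,j)\to(m-t-1,j-1)$ with label $1$; $(m,j)\to(m-t-1,j)$ with label $2$. A directed path from $(n,k)$ to $(m,j)$ is a finite sequence of vertices $(m_0,j_0),\dots,(m_r,j_r)$ with $(m_0,j_0)=(n,k)$, $(m_r,j_r)=(m,j)$ and each $(m_i,j_i)\to(m_{i+1},j_{i+1})$ an edge; its label sum is the sum of the labels of all its $r$ edges. *)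

(* Defs.v *)
From HB Require Import structures.
From mathcomp Require Import all_boot all_order all_algebra finmap zify.
From mathcomp Require Import all_classical all_reals all_analysis homotopy.
(* A full import of [mpoly] would clash with the notations of the analysis
   library. *)
From mathcomp Require Import (canonicals, coercions) mpoly.

Set Implicit Arguments.
Unset Strict Implicit.
Unset Printing Implicit Defensive.

Import Order.TTheory GRing.Theory Num.Theory numFieldNormedType.Exports.

Local Open Scope classical_set_scope.
Local Open Scope ring_scope.

(* Vertices are allowed not to be faces, so that a complex "on [m]" always has
   the ground set ['I_m].  Both the void complex (no face at all) and the
   complex [{set0}] without vertices are included. *)
Record scomplex := SComplex {
  ground : finType;
  faces : {set {set ground}};
  faces_sub : forall F G : {set ground},
    F \in faces -> G \subset F -> G \in faces }.

Lemma simplex_sub (V : finType) (F G : {set V}) :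
  F \in [set: {set V}]%SET -> G \subset F -> G \in [set: {set V}]%SET.
Proof. by rewrite !finset.in_setT. Qed.

Definition simplex (V : finType) : scomplex := SComplex (@simplex_sub V).

Definition dual_faces (L : scomplex) : {set {set ground L}} :=
  [set (~: F)%SET | F : {set ground L} & F \notin faces L]%SET.

Lemma dual_faces_sub (L : scomplex) (F G : {set ground L}) :
  F \in dual_faces L -> G \subset F -> G \in dual_faces L.
Proof.
move=> /imsetP[H]; rewrite inE => HL -> GH; apply/imsetP.
exists (~: G)%SET; last by rewrite finset.setCK.
rewrite inE; apply: contra HL => /faces_sub; apply.
by rewrite -(finset.setCK H) finset.setCS.
Qed.

Definition alexander_dual (L : scomplex) : scomplex :=
  SComplex (@dual_faces_sub L).

Definition join_faces (L M : scomplex) : {set {set (ground L + ground M)}} :=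
  [set F : {set (ground L + ground M)} |
     ((inl @^-1: F)%SET \in faces L) && ((inr @^-1: F)%SET \in faces M)]%SET.

Lemma join_faces_sub (L M : scomplex) (F G : {set (ground L + ground M)}) :
  F \in join_faces L M -> G \subset F -> G \in join_faces L M.
Proof.
rewrite !inE => /andP[FL FM] GF.
by rewrite (faces_sub FL) ?(faces_sub FM) ?preimsetS.
Qed.

Definition join (L M : scomplex) : scomplex := SComplex (@join_faces_sub L M).

Lemma two_points_sub (F G : {set bool}) :
  F \in [set H : {set bool} | (#|H| <= 1)%N]%SET -> G \subset F ->
  G \in [set H : {set bool} | (#|H| <= 1)%N]%SET.
Proof. by rewrite !inE => F1 /subset_leq_card /leq_trans; apply. Qed.

Definition two_points : scomplex := SComplex two_points_sub.

Definition susp (L : scomplex) : scomplex := join L two_points.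

Definition ideal_gen (A : comNzRingType) (S : set A) : set A :=
  [set p | exists s : seq (A * A),
     (forall x, x \in s -> S x.2) /\ p = \sum_(x <- s) x.1 * x.2].

Definition mono (K : fieldType) (m : nat) (F : {set 'I_m}) : mpoly.mpoly m K :=
  \prod_(i in F) mpoly.mpolyX K (mpoly.mnm1 i).

Definition stanley_reisner_faces (K : fieldType) (m : nat)
    (S : set (mpoly.mpoly m K)) : {set {set 'I_m}} :=
  [set F | ~~ `[< ideal_gen S (mono K F) >]]%SET.

Lemma ideal_gen_mull (A : comNzRingType) (S : set A) (c p : A) :
  ideal_gen S p -> ideal_gen S (c * p).
Proof.
move=> [s [sS ->]]; exists [seq (c * x.1, x.2) | x <- s]; split.
  by move=> _ /mapP[x /sS xS ->].
by rewrite big_map mulr_sumr; apply: eq_bigr => x _; rewrite mulrA.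
Qed.

Lemma mono_subset (K : fieldType) (m : nat) (F G : {set 'I_m}) :
  G \subset F -> mono K F = mono K (F :\: G)%SET * mono K G.
Proof.
by move=> GF; rewrite /mono (big_setID G) /= (finset.setIidPr GF) mulrC.
Qed.

Lemma stanley_reisner_sub (K : fieldType) (m : nat)
    (S : set (mpoly.mpoly m K)) (F G : {set 'I_m}) :
  F \in stanley_reisner_faces S -> G \subset F ->
  G \in stanley_reisner_faces S.
Proof.
rewrite !inE => /asboolPn FS GF; apply/asboolPn; apply: contra_not FS.
by rewrite (mono_subset K GF); exact: ideal_gen_mull.
Qed.

(* The Stanley-Reisner complex of the ideal generated by [S]. *)
Definition stanley_reisner (K : fieldType) (m : nat)
  (S : set (mpoly.mpoly m K)) : scomplex := SComplex (@stanley_reisner_sub K m S).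

(* Variables are numbered from 0: the paths on [t] vertices of the path graph
   are the sets {i, ..., i+t-1} with i+t <= m. *)
Definition t_path (m t : nat) (F : {set 'I_m}) : Prop :=
  exists2 i : nat, (i + t <= m)%N & F = [set x : 'I_m | (i <= x < i + t)%N]%SET.

Definition sqfree_power_gens (K : fieldType) (m t j : nat) :
    set (mpoly.mpoly m K) :=
  [set p | exists e : 'I_j -> {set 'I_m},
     [/\ forall a, t_path t (e a),
         forall a b, a != b -> [disjoint e a & e b]%B &
         p = \prod_(a < j) mono K (e a)]].
Arguments sqfree_power_gens : clear implicits.

Definition Sigma_complex (K : fieldType) (m t j : nat) : scomplex :=
  stanley_reisner (sqfree_power_gens K m t j).

Definition Delta (K : fieldType) (m t j : nat) : scomplex :=
  if j is 0%N then simplex 'I_m else alexander_dual (Sigma_complex K m t j).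

Definition realization_set (R : realType) (L : scomplex) :
    set {ptws ground L -> R} :=
  [set x | [/\ forall v, 0 <= x v, \sum_(v : ground L) x v = 1 &
               [set v | x v != 0]%SET \in faces L]].
Arguments realization_set : clear implicits.

Definition realization (R : realType) (L : scomplex) : topologicalType :=
  realization_set R L.

Definition homotopic (R : realType) (X Y : topologicalType) (f g : X -> Y) :=
  exists H : X * R -> Y,
    [/\ {within [set: X] `*` `[0, 1], continuous H},
        forall x, H (x, 0) = f x & forall x, H (x, 1) = g x].

Definition homotopy_equivalent (R : realType) (X Y : topologicalType) :=
  exists (f : X -> Y) (g : Y -> X),
    [/\ continuous f, continuous g,
        homotopic R (g \o f) id & homotopic R (f \o g) id].

(* The library's [wedge] of an empty family is the empty space.  Adding a
   one-point summand makes the empty wedge a point, and does not change the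
   wedge of a nonempty family. *)
Definition with_point (I : Type) (X : I -> topologicalType) (o : option I) :
  topologicalType := if o is Some i then X i else discrete_topology unit.

Definition with_point_base (I : Type) (X : I -> topologicalType)
    (p0 : forall i, X i) (o : option I) : with_point X o :=
  match o with Some i => p0 i | None => tt end.

Definition wedge_sum (I : choiceType) (X : I -> topologicalType)
  (p0 : forall i, X i) : topologicalType := wedge (with_point_base p0).

Definition is_vertex (n k t : nat) (u : nat * nat) : bool :=
  ((u.2 <= k) && (u.2 * t <= u.1 <= n - (k - u.2) * t))%N.

(* The targets of the edges out of [u], the edge with label [l] being the one
   to the [l]-th target.  They are pairwise distinct when [u] has outgoing
   edges. *)
Definition targets (t : nat) (u : nat * nat) : seq (nat * nat) :=
  [:: (u.1 - t, u.2.-1)%N; (u.1 - t.+1, u.2.-1)%N; (u.1 - t.+1, u.2)%N].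

Definition edge (n k t : nat) (u v : nat * nat) : bool :=
  [&& is_vertex n k t u, 0 < u.2, u.2 * t + t + 1 <= u.1 & v \in targets t u]%N.

Definition label (t : nat) (u v : nat * nat) : nat := index v (targets t u).

(* [p] lists the vertices following the initial vertex (n, k). *)
Definition dipaths (n k t m j alpha : nat) : set (seq (nat * nat)) :=
  [set p | [/\ all (is_vertex n k t) ((n, k) :: p),
               path (edge n k t) (n, k) p,
               last (n, k) p = (m, j) &
               sumn (pairmap (label t) (n, k) p) = alpha]].

Lemma finite_dipaths (n k t m j alpha : nat) :
  finite_set (dipaths n k t m j alpha).
Proof.
have szp u p : path (edge n k t) u p -> (size p <= u.1 + u.2)%N.
  elim: p u => //= v p IH u /andP[/and4P[_ u0 ut]].
  by rewrite !inE => /or3P[]/eqP-> /IH /=; lia.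
have sub : dipaths n k t m j alpha `<=`
    [set [seq ((w.1 : nat), (w.2 : nat)) |
        w : 'I_n.+1 * 'I_k.+1 <- val q] |
       q in [set: (n + k).-bseq ('I_n.+1 * 'I_k.+1)]].
  move=> p [/andP[_ /allP pV] /szp sp _ _].
  have sq : (size [seq ((inord w.1 : 'I_n.+1), (inord w.2 : 'I_k.+1)) | w <- p]
      <= n + k)%N by rewrite size_map.
  exists (Bseq sq) => //=; rewrite -map_comp -[RHS]map_id.
  apply/eq_in_map => -[x y] /pV /andP[/= yk /andP[_ xn]] /=.
  by rewrite !inordK //; lia.
apply: (sub_finite_set sub); apply: finite_image; exact: finite_finset.
Qed.

Definition npaths (n k t m j alpha : nat) : nat :=
  #|` fset_set (dipaths n k t m j alpha)|.

(* A triple ((m, j), alpha) stands for the summand Sigma^alpha (Delta m t j). *)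
Definition admissible (k t : nat) (x : nat * nat * nat) : bool :=
  let: (m, j, _) := x in ((1 <= j <= k) && (j * t <= m <= j * t + t))%N.

(* One index per admissible triple and per copy of the summand. *)
Definition windex (n k t : nat) : choiceType :=
  {x : {x : nat * nat * nat | admissible k t x} &
     'I_(npaths n k t (val x).1.1 (val x).1.2 (val x).2)}.

Definition summand_complex (K : fieldType) (t : nat) (x : nat * nat * nat) :
  scomplex := iter x.2 susp (Delta K x.1.1 t x.1.2).

Definition summand (R : realType) (K : fieldType) (n k t : nat)
    (i : windex n k t) : topologicalType :=
  realization R (summand_complex K t (val (tag i))).

(* A path of label sum 0 preserves m - j * t, so only
    suspensions with alpha > 0 occur; each of them is pointed by a pole. *)

Lemma dipath_label0 (n k t : nat) (u : nat * nat) (p : seq (nat * nat)) :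
  path (edge n k t) u p -> sumn (pairmap (label t) u p) = 0%N ->
  (u.1 + (last u p).2 * t = (last u p).1 + u.2 * t)%N.
Proof.
elim: p u => //= v p IH [x y] /andP[/and4P[_ /= y0 xt vt] vp] /eqP.
rewrite addn_eq0 => /andP[/eqP l0 /eqP s0].
move: (IH v vp s0); have -> : v = (x - t, y.-1)%N.
  by rewrite -(nth_index (0, 0)%N vt) -/(label t (x, y) v) l0.
case: y y0 xt {l0 vt} => // y _ /=; rewrite mulSn => xt; lia.
Qed.

Lemma windex_alpha_gt0 (n k t : nat) (hn : (t < n - k * t)%N)
  (i : windex n k t) : (0 < (val (tag i)).2)%N.
Proof.
case: i => -[[[m j] [|a]] /= /and3P[jk mt1 mt2]] // [c /= cN].
have : fset_set (dipaths n k t m j 0) != fset0.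
  by rewrite -cardfs_gt0; exact: leq_ltn_trans cN.
case/fset0Pn => p; rewrite in_fset_set; last exact: finite_dipaths.
rewrite inE => -[_ pp lp sp].
by have := dipath_label0 pp sp; rewrite lp /=; lia.
Qed.

Lemma set0_susp (L : scomplex) :
  finset.set0 \in faces L -> finset.set0 \in faces (susp L).
Proof. by move=> L0; rewrite /= inE !preimset0 L0 inE cards0. Qed.

Lemma set0_iter_susp (L : scomplex) (a : nat) :
  finset.set0 \in faces L -> finset.set0 \in faces (iter a susp L).
Proof. by move=> L0; elim: a => //= a; exact: set0_susp. Qed.

Lemma set0_Delta (K : fieldType) (m t j : nat) :
  (j * t <= m)%N -> finset.set0 \in faces (Delta K m t j).
Proof.
case: j => [|j] jm; first by rewrite inE.
pose e (a : 'I_j.+1) := [set x : 'I_m | (a * t <= x < a * t + t)%N]%SET.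
have et a : t_path t (e a).
  exists (a * t)%N => //; rewrite addnC -mulSn; apply: leq_trans jm.
  by rewrite leq_mul2r ltn_ord orbT.
have ed a b : a != b -> [disjoint e a & e b]%B.
  move=> ab; rewrite -setI_eq0; apply/eqP/setP => x; rewrite !inE.
  apply/negbTE/negP => /andP[/andP[a1 a2] /andP[b1 b2]].
  case: (ltngtP a b) => [lt|lt|/val_inj/eqP]; last by rewrite (negbTE ab).
  - by have := leq_mul lt (leqnn t); rewrite mulSn; lia.
  - by have := leq_mul lt (leqnn t); rewrite mulSn; lia.
apply/imsetP; exists [set: 'I_m]%SET; last by rewrite finset.setCT.
rewrite inE /= inE negbK; apply/asboolP.
pose U := (\bigcup_(a < j.+1) e a)%SET.
rewrite (mono_subset K (finset.subsetT U)); apply: ideal_gen_mull.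
exists [:: (1, mono K U)]; split; last by rewrite big_seq1 mul1r.
move=> x; rewrite inE => /eqP -> /=; exists e; split => //.
rewrite /mono /U partition_disjoint_bigcup //.
Qed.

Definition vertex_fun (R : realType) (V : finType) (v : V) : {ptws V -> R} :=
  fun w => (w == v)%:R.

Lemma vertex_realization (R : realType) (L : scomplex) (v : ground L) :
  [set v]%SET \in faces L -> realization_set R L (vertex_fun R v).
Proof.
rewrite /vertex_fun => vL; split=> [w||]; first exact: ler0n.
- rewrite (bigD1 v) //= eqxx big1 ?addr0 // => w /negbTE -> //.
- suff -> : [set w | (w == v)%:R != 0 :> R]%SET = [set v]%SET by [].
  by apply/setP => w; rewrite !inE pnatr_eq0 eqb0 negbK.
Qed.

Lemma pole_face (L : scomplex) : finset.set0 \in faces L ->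
  [set (inr true : ground (susp L))]%SET \in faces (susp L).
Proof.
move=> L0; rewrite /= inE inE; apply/andP; split.
  by rewrite (_ : (_ @^-1: _)%SET = finset.set0) //; apply/setP => v; rewrite !inE.
by rewrite (_ : (_ @^-1: _)%SET = [set true]%SET) ?cards1 //; apply/setP => v; rewrite !inE.
Qed.

Definition pole (R : realType) (L : scomplex) (L0 : finset.set0 \in faces L) :
    realization R (susp L) :=
  SigSub (mem_set (vertex_realization R (pole_face L0))).

Definition iter_pole (R : realType) (L : scomplex)
    (L0 : finset.set0 \in faces L) (a : nat) :
    (0 < a)%N -> realization R (iter a susp L) :=
  match a return (0 < a)%N -> realization R (iter a susp L) with
  | 0%N => fun a0 => False_rect _ (notF a0)
  | b.+1 => fun _ => pole R (set0_iter_susp b L0)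
  end.

Lemma admissible_mul_le (k t : nat) (x : nat * nat * nat) :
  admissible k t x -> (x.1.2 * t <= x.1.1)%N.
Proof. by case: x => -[m j] a /= /and3P[]. Qed.

Definition summand_base (R : realType) (K : fieldType) (n k t : nat)
    (hn : (t < n - k * t)%N) (i : windex n k t) : summand R K i :=
  iter_pole R (set0_Delta K (admissible_mul_le (valP (tag i))))
    (windex_alpha_gt0 hn i).

(* Main.v *)
(* The complex Delta n t k consists of the sets F such that [0, n) contains k
   disjoint intervals of length t avoiding F.

   If the link of a vertex v of a complex lies in the star of another vertex w,
   then deleting v and gluing, at w, a suspension of the link of v does not
   change the homotopy type.  With n = m + t + 1, apply this to Delta n t (k+1):
   the positions m+1, ..., m+t-1 are dominated by the last one, v = m + t, and
   can be removed; then the deletion of v is Delta (m+1) t k, and the link E of v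
   lies in the star of w = m, because dropping the last interval frees w.  The
   same argument in E, with the vertex m and the star of 0, which is freed by
   dropping the first interval, exhibits E as Delta m t k with a suspension of
   Delta m t (k+1) attached.  Hence Delta n t (k+1) is a wedge of Delta (m+1) t k,
   of the suspension of Delta m t k and of the double suspension of
   Delta m t (k+1), and these are the three edges of the graph.

   All this takes place among pointed finite complexes, up to the relation
   generated by isomorphisms, moves of the base point along an edge, and removals
   of the faces containing a face whose link is a cone.  These moves are
   compatible with gluing suspensions, so that base points never have to be
   matched by hand.  They are turned into homotopy equivalences of realizations
   once and for all, and a union of suspensions along a common pole is
   homeomorphic to the topological wedge. *)
Require Import Defs.
From mathcomp Require Import all_boot all_order all_algebra finmap zify lra.
From mathcomp Require Import all_classical all_reals all_analysis homotopy.
From mathcomp Require Import (canonicals, coercions) mpoly.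

Set Implicit Arguments.
Unset Strict Implicit.
Unset Printing Implicit Defensive.

Import Order.TTheory GRing.Theory Num.Theory numFieldNormedType.Exports.

Local Open Scope classical_set_scope.
Local Open Scope ring_scope.

(** * Homotopy *)

(** The obstacle is that a terminal complex may have no vertex, hence no base point: only its
    suspensions can be pointed. So [Att P X] attaches to a pointed [P] an unpointed [X], and the
    induction speaks of [Att P X] for every [P]. A statement about the pointed complex itself is
    made only when m > j * t + t, where all the summands are suspensions. As an attachment suspends
    what it attaches, the summand Sigma^alpha comes from attaching Sigma^(alpha - 1).

    The labels count nested attachments: label 1 is the deletion inside the link E, suspended once
    with E; label 2 is the link inside E, suspended once within E and once more with E. The
    equivalence Sigma(Q v Sigma X) = Sigma Q v Sigma^2 X, which flattens this nesting, is itself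
    obtained by deleting a vertex whose link lies in a star. Targets with j = 0 give contractible
    simplices, which is why the wedge has j >= 1 only. The only nonconstant homotopy written down is
    the straight line of a single collapse. *)

Lemma continuous_comp_within (X Y Z : topologicalType) (A : set Y) (h : X -> Y)
    (f : Y -> Z) :
  continuous h -> (forall x, A (h x)) -> {within A, continuous f} ->
  continuous (f \o h).
Proof.
move=> ch hA /continuous_closedP cf; apply/continuous_closedP => W cW.
have /closed_subspaceP[V cV VW] := cf _ cW.
have -> : (f \o h) @^-1` W = h @^-1` V.
  apply/seteqP; split=> x /= Hx.
    by have [] : (V `&` A) (h x) by rewrite VW; split.
  by have [] : (f @^-1` W `&` A) (h x) by rewrite -VW; split.
by move/continuous_closedP : ch; exact.
Qed.

Lemma continuous_pair (X Y Z : topologicalType) (f : X -> Y) (g : X -> Z) :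
  continuous f -> continuous g -> continuous (fun x => (f x, g x)).
Proof. by move=> cf cg x; apply: cvg_pair; [exact: cf | exact: cg]. Qed.

Section Homotopy.
Variable R : realType.

Definition clamp (s : R) : R := Num.min 1 (Num.max 0 s).

Lemma clamp_continuous : continuous clamp.
Proof.
move=> s; apply: (@continuous_min R R (fun=> 1) (fun s => Num.max 0 s)).
  exact: cst_continuous.
apply: (@continuous_max R R (fun=> 0) id); first exact: cst_continuous.
exact: cvg_id.
Qed.

Lemma clamp_ge0 s : 0 <= clamp s.
Proof. by rewrite /clamp le_min ler01 le_max lexx. Qed.

Lemma clamp_le1 s : clamp s <= 1.
Proof. by rewrite /clamp ge_min lexx. Qed.

Lemma clamp0 : clamp 0 = 0.
Proof. by rewrite /clamp maxxx min_r ?ler01. Qed.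

Lemma clamp1 : clamp 1 = 1.
Proof. by rewrite /clamp max_r ?ler01 ?minxx. Qed.

(** [homotopic] asks for continuity on [0, 1] only. Composing the time with [clamp], the retraction
    of the line onto [0, 1], yields a map continuous everywhere, which can then be rescaled and
    composed freely. *)
Lemma homotopic_total (X Y : topologicalType) (f g : X -> Y) :
  homotopic R f g -> exists H : X * R -> Y,
    [/\ continuous H, forall x, H (x, 0) = f x & forall x, H (x, 1) = g x].
Proof.
move=> [H [cH H0 H1]]; exists (H \o (fun z => (z.1, clamp z.2))); split.
- apply: (continuous_comp_within _ _ cH) => [|z /=].
    apply: continuous_pair => z; first exact: cvg_fst.
    by apply: continuous_comp; [exact: cvg_snd|exact: clamp_continuous].
  by split=> //; rewrite /= in_itv /= clamp_ge0 clamp_le1.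
- by move=> x /=; rewrite clamp0.
- by move=> x /=; rewrite clamp1.
Qed.

Lemma homotopic_refl (X Y : topologicalType) (f : X -> Y) :
  continuous f -> homotopic R f f.
Proof.
move=> cf; exists (f \o fst); split=> //; apply: continuous_subspaceT => x.
by apply: continuous_comp; [exact: cvg_fst | exact: cf].
Qed.

Lemma homotopic_trans (X Y : topologicalType) (f g h : X -> Y) :
  homotopic R f g -> homotopic R g h -> homotopic R f h.
Proof.
move=> /homotopic_total[H [cH H0 H1]] /homotopic_total[G [cG G0 G1]].
pose A := [set z : X * R | z.2 <= 2^-1]; pose B := [set z : X * R | 2^-1 <= z.2].
have csnd : continuous (@snd X R) by move=> z; exact: cvg_snd.
have cA : closed A by move/continuous_closedP/(_ _ (@closed_le R 2^-1)): csnd.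
have cB : closed B by move/continuous_closedP/(_ _ (@closed_ge R 2^-1)): csnd.
have cscale (a b : R) : continuous (fun z : X * R => (z.1, a * z.2 + b)).
  apply: continuous_pair => z; first exact: cvg_fst.
  apply: cvgD; last exact: cvg_cst.
  by apply: cvgM; [exact: cvg_cst | exact: csnd].
exists (fun z => if z.2 <= 2^-1 then H (z.1, 2 * z.2 + 0) else G (z.1, 2 * z.2 + - 1)).
split.
- apply: (continuous_subspaceW (@subsetT _ _)).
  have -> : [set: X * R] = A `|` B.
    by apply/seteqP; split=> // z _; case: (leP z.2 2^-1) => [|/ltW]; [left|right].
  apply: withinU_continuous => //.
    apply: (@subspace_eq_continuous _ _ _ (fun z : X * R => H (z.1, 2 * z.2 + 0))).
      by move=> z /set_mem zA; rewrite /from_subspace ifT.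
    apply: continuous_subspaceT => z.
    by apply: (@continuous_comp _ _ _ (fun z : X * R => (z.1, 2 * z.2 + 0)));
       [exact: cscale | exact: cH].
  apply: (@subspace_eq_continuous _ _ _ (fun z : X * R => G (z.1, 2 * z.2 + - 1))).
    move=> z /set_mem zB; rewrite /from_subspace; case: ifPn => // zA.
    have -> : z.2 = 2^-1 by apply/le_anti; rewrite zA; exact: zB.
    by rewrite divff ?addr0 ?subrr ?H1 ?G0 // pnatr_eq0.
  apply: continuous_subspaceT => z.
  by apply: (@continuous_comp _ _ _ (fun z : X * R => (z.1, 2 * z.2 + -1)));
       [exact: cscale | exact: cG].
- by move=> x /=; rewrite invr_ge0 ler0n mulr0 addr0 H0.
- move=> x /=; rewrite leNgt invf_lt1 ?ltr1n ?ltr0n //= mulr1.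
  by rewrite (_ : 2 + -1 = 1 :> R) ?G1 //; lra.
Qed.

Lemma homotopic_comp (X Y Z W : topologicalType) (h : X -> Y) (f g : Y -> Z)
    (k : Z -> W) :
  continuous h -> continuous k -> homotopic R f g ->
  homotopic R (k \o f \o h) (k \o g \o h).
Proof.
move=> ch ck /homotopic_total[H [cH H0 H1]].
exists (k \o (H \o (fun z => (h z.1, z.2)))); split.
- apply: continuous_subspaceT => z; apply: continuous_comp; last exact: ck.
  apply: continuous_comp; last exact: cH.
  apply: continuous_pair => {}z; last exact: cvg_snd.
  by apply: continuous_comp; [exact: cvg_fst | exact: ch].
- by move=> x /=; rewrite H0.
- by move=> x /=; rewrite H1.
Qed.

Lemma homotopy_equivalent_refl (X : topologicalType) :
  homotopy_equivalent R X X.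
Proof.
exists id, id; split=> //; try by move=> x; exact: cvg_id.
all: by apply: homotopic_refl => x; exact: cvg_id.
Qed.

Lemma homotopy_equivalent_sym (X Y : topologicalType) :
  homotopy_equivalent R X Y -> homotopy_equivalent R Y X.
Proof. by move=> [f [g [cf cg gf fg]]]; exists g, f; split. Qed.

Lemma homotopy_equivalent_trans (X Y Z : topologicalType) :
  homotopy_equivalent R X Y -> homotopy_equivalent R Y Z ->
  homotopy_equivalent R X Z.
Proof.
move=> [f [g [cf cg gf fg]]] [f' [g' [cf' cg' gf' fg']]].
have cc (U V W : topologicalType) (u : U -> V) (v : V -> W) :
    continuous u -> continuous v -> continuous (v \o u).
  by move=> cu cv x; apply: continuous_comp; [exact: cu | exact: cv].
exists (f' \o f), (g \o g'); split; [exact: cc|exact: cc| |].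
- exact: homotopic_trans (homotopic_comp cf cg gf') gf.
- exact: homotopic_trans (homotopic_comp cg' cf' fg) fg'.
Qed.

End Homotopy.

(** * Maps between realizations *)

Section Realization.
Variable R : realType.
Implicit Types L M : scomplex.

Definition weight L (x : realization R L) (v : ground L) : R := (val x : ground L -> R) v.

Definition rsupp (V : finType) (x : V -> R) : {set V} := [set v | x v != 0]%SET.

Definition rpoint L (x : ground L -> R) (h : realization_set R L x) :
  realization R L := SigSub (mem_set h).

Lemma weight_rpoint L x (h : realization_set R L x) : weight (rpoint h) = x.
Proof. by []. Qed.

Lemma weightP L (x : realization R L) : realization_set R L (weight x).
Proof. exact: set_mem (valP x). Qed.

Lemma weight_ge0 L (x : realization R L) v : 0 <= weight x v.
Proof. by have [+ _ _] := weightP x; apply. Qed.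

Lemma weight_sum L (x : realization R L) : \sum_v weight x v = 1.
Proof. by have [] := weightP x. Qed.

Lemma weight_face L (x : realization R L) : rsupp (weight x) \in faces L.
Proof. by have [] := weightP x. Qed.

Lemma weight_inj L : injective (@weight L).
Proof. by move=> x y xy; apply: val_inj; exact: xy. Qed.

Lemma weight_continuous L v : continuous (fun x : realization R L => weight x v).
Proof.
move=> x; apply: (@continuous_comp _ _ _ (set_val : realization R L -> {ptws ground L -> R})
  (fun f : {ptws ground L -> R} => f v)).
  exact: initial_continuous.
exact: (@proj_continuous _ (fun=> R) v).
Qed.

Lemma realization_continuous (T : topologicalType) L (f : T -> realization R L) :
  (forall v, continuous (fun x => weight (f x) v)) -> continuous f.
Proof.
move=> cf; apply: continuous_comp_initial => x.
apply/cvg_sup => v; apply: (@continuous_comp_initial _ T R (fun f => f v)).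
exact: cf.
Qed.

Lemma continuous_addMn (T : topologicalType) (f g : T -> R) n :
  continuous f -> continuous g -> continuous (fun x => f x + g x *+ n).
Proof. by move=> cf cg x; apply: cvgD; [exact: cf|apply: cvgMn; exact: cg]. Qed.

Lemma continuous_subr (T : topologicalType) (f g : T -> R) :
  continuous f -> continuous g -> continuous (fun x => f x - g x).
Proof. by move=> cf cg x; apply: cvgB; [exact: cf|exact: cg]. Qed.

Lemma continuous_sumr (T : topologicalType) (I : Type) (r : seq I) (P : pred I)
    (F : I -> T -> R) :
  (forall i, continuous (F i)) ->
  continuous (fun x => \sum_(i <- r | P i) F i x).
Proof.
move=> cF; elim: r => [|i r IH] x.
  by under eq_fun do rewrite big_nil; exact: cvg_cst.
under eq_fun do rewrite big_cons; case: (P i); last exact: IH.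
by apply: cvgD; [exact: cF|exact: IH].
Qed.

Section Straight.
Variables (T : topologicalType) (L : scomplex) (f g : T -> realization R L).
Hypothesis fg : forall x,
  (rsupp (weight (f x)) :|: rsupp (weight (g x)))%SET \in faces L.

Definition mix (z : T * R) (v : ground L) : R :=
  (1 - clamp z.2) * weight (f z.1) v + clamp z.2 * weight (g z.1) v.

Lemma mixP z : realization_set R L (mix z).
Proof.
have c0 := clamp_ge0 z.2; have c1 := clamp_le1 z.2.
split=> [v||].
- by rewrite addr_ge0 ?mulr_ge0 ?weight_ge0 // subr_ge0.
- by rewrite big_split /= -!mulr_sumr !weight_sum !mulr1 subrK.
- apply: faces_sub (fg z.1) _; apply/fintype.subsetP => v; rewrite !inE.
  apply: contraNT; rewrite negb_or !negbK /mix => /andP[/eqP -> /eqP ->].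
  by rewrite !mulr0 addr0.
Qed.

(** Contiguity: at each point the two supports span a common face, so the segment between the two
    images stays in the realization. *)
Lemma straight_homotopic : continuous f -> continuous g -> homotopic R f g.
Proof.
move=> cf cg; exists (fun z => rpoint (mixP z)); split.
- apply: continuous_subspaceT; apply: realization_continuous => v z.
  have c2 : continuous (fun z : T * R => clamp z.2).
    by move=> y; apply: continuous_comp; [exact: cvg_snd|exact: clamp_continuous].
  have cw (h : T -> realization R L) : continuous h ->
      continuous (fun z : T * R => weight (h z.1) v).
    move=> ch y; apply: (@continuous_comp _ _ _ (fun y : T * R => h y.1)
      (fun p => weight p v)); last exact: weight_continuous.
    by apply: continuous_comp; [exact: cvg_fst|exact: ch].
  apply: cvgD; apply: cvgM; [|exact: cw|exact: c2|exact: cw].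
  by apply: cvgB; [exact: cvg_cst|exact: c2].
- by move=> x; apply: weight_inj; apply/funext => v;
    rewrite weight_rpoint /mix clamp0 subr0 mul1r mul0r addr0.
- by move=> x; apply: weight_inj; apply/funext => v;
    rewrite weight_rpoint /mix clamp1 subrr mul1r mul0r add0r.
Qed.

End Straight.

(** The pushforward of a weight seen as a measure on the vertices, that is, the affine extension of
    the vertex map [f]. *)
Definition pushw (V W : finType) (f : V -> W) (x : V -> R) (w : W) : R :=
  \sum_(v | f v == w) x v.

Lemma rsupp_pushw L (W : finType) (f : ground L -> W) (x : realization R L) :
  rsupp (pushw f (weight x)) = (f @: rsupp (weight x))%SET.
Proof.
apply/setP => w; rewrite !inE /pushw psumr_neq0; last first.
  by move=> v _; exact: weight_ge0.
apply/hasP/imsetP => [[v _ /andP[/eqP fv xv]]|[v]].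
  by exists v; rewrite // inE lt0r_neq0.
rewrite inE => xv ->; exists v; first by rewrite mem_index_enum.
by rewrite eqxx lt0r xv weight_ge0.
Qed.

Lemma pushwP L M (f : ground L -> ground M) :
  (forall F, F \in faces L -> (f @: F)%SET \in faces M) ->
  forall x : realization R L, realization_set R M (pushw f (weight x)).
Proof.
move=> fLM x; split=> [w||].
- by apply: sumr_ge0 => v _; exact: weight_ge0.
- by rewrite -(weight_sum x) (partition_big f xpredT).
- rewrite -/(rsupp (pushw f (weight x))) rsupp_pushw.
  exact/fLM/weight_face.
Qed.

Definition push L M (f : ground L -> ground M)
    (fLM : forall F, F \in faces L -> (f @: F)%SET \in faces M)
    (x : realization R L) : realization R M := rpoint (pushwP fLM x).

Lemma push_continuous L M (f : ground L -> ground M) fLM :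
  continuous (@push L M f fLM).
Proof.
apply: realization_continuous => w.
by apply: continuous_sumr => v; exact: weight_continuous.
Qed.

Lemma weight0 L (x : realization R L) v :
  v \notin rsupp (weight x) -> weight x v = 0.
Proof. by rewrite inE negbK => /eqP. Qed.

Lemma pushw_id L (x : realization R L) (h : ground L -> ground L) :
  {in rsupp (weight x), h =1 id} -> pushw h (weight x) = weight x.
Proof.
move=> hid; apply/funext => v; rewrite /pushw big_mkcond /= (bigD1 v) //=.
rewrite big1 ?addr0 => [|w wv].
  case: (boolP (v \in rsupp (weight x))) => [/hid ->|/weight0 ->].
    by rewrite eqxx.
  by rewrite if_same.
case: (boolP (w \in rsupp (weight x))) => [/hid ->|/weight0 ->].
  by rewrite (negbTE wv).
by rewrite if_same.
Qed.

Lemma pushw_comp (U V W : finType) (f : U -> V) (g : V -> W) x :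
  pushw g (pushw f x) = pushw (g \o f) x.
Proof.
apply/funext => w; rewrite /pushw.
rewrite [RHS](partition_big f (fun v => g v == w)) //=.
apply: eq_bigr => v /eqP gv; apply: eq_bigl => u /=.
by case: (eqVneq (f u) v) => [->|]; rewrite ?gv ?eqxx // andbF.
Qed.

(** Points carry weight on actual vertices only. It is therefore enough that the maps be inverse to
    each other there, and ground elements that are not vertices do no harm. *)
Lemma homotopy_equivalent_push L M (f : ground L -> ground M)
    (g : ground M -> ground L) :
  (forall F, F \in faces L -> (f @: F)%SET \in faces M) ->
  (forall F, F \in faces M -> (g @: F)%SET \in faces L) ->
  (forall v, [set v]%SET \in faces L -> g (f v) = v) ->
  (forall w, [set w]%SET \in faces M -> f (g w) = w) ->
  homotopy_equivalent R (realization R L) (realization R M).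
Proof.
move=> fP gP gf fg; exists (push fP), (push gP).
have K L' M' (f' : ground L' -> ground M') (g' : ground M' -> ground L') fP' gP' :
    (forall v, [set v]%SET \in faces L' -> g' (f' v) = v) ->
    @push M' L' g' gP' \o @push L' M' f' fP' = id.
  move=> g'f'; apply/funext => x; apply: weight_inj.
  rewrite weight_rpoint pushw_comp pushw_id // => v vx; apply: g'f'.
  by apply: faces_sub (weight_face x) _; rewrite finset.sub1set.
split; [exact: push_continuous|exact: push_continuous| |].
- by rewrite K //; apply: homotopic_refl => x; exact: cvg_id.
- by rewrite K //; apply: homotopic_refl => x; exact: cvg_id.
Qed.

End Realization.

(* The retraction moves mass from the vertices of F to g, in equal amounts,
   until one of the weights on F vanishes. *)
Section Collapse.
Variables (R : realType) (V : finType) (A B : {set {set V}}).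
Variables (hA : forall F G : {set V}, F \in A -> G \subset F -> G \in A).
Variables (hB : forall F G : {set V}, F \in B -> G \subset F -> G \in B).
Variables (F : {set V}) (f g : V).
Hypotheses (Ff : f \in F) (Fg : g \notin F).
Hypothesis FgA : forall S, S \in A -> F \subset S -> (g |: S)%SET \in A.
Hypothesis defB : forall S, (S \in B) = (S \in A) && ~~ (F \subset S).
Let L := SComplex hA.
Let M := SComplex hB.

(** The minimum of the weights on [F]. The initial value [x f], with [f] in [F], does not alter it
    and replaces the missing neutral element. *)
Definition slack (x : V -> R) : R := \big[Num.min/x f]_(v in F) x v.

Lemma slack_le x v : v \in F -> slack x <= x v.
Proof. by move=> vF; apply: bigmin_le_cond. Qed.

Lemma slack_attained x : exists2 v, v \in F & slack x = x v.
Proof.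
rewrite /slack; elim/big_ind : _ => [|a b [v vF ->] [w wF ->]|v vF].
- by exists f.
- by rewrite minElt; case: ifP; [exists v|exists w].
- by exists v.
Qed.

Definition squeeze (x : V -> R) (v : V) : R :=
  if v == g then x v + slack x *+ #|F|
  else if v \in F then x v - slack x else x v.

Lemma slack_ge0 (x : realization R L) : 0 <= slack (weight x).
Proof. by have [v _ ->] := slack_attained (weight x); exact: weight_ge0. Qed.

Lemma slack0 (x : realization R L) :
  ~~ (F \subset rsupp (weight x)) -> slack (weight x) = 0.
Proof.
case/fintype.subsetPn => v vF vx; apply/le_anti; rewrite slack_ge0 andbT.
by rewrite -(weight0 vx) slack_le.
Qed.

Lemma rsupp_squeeze (x : realization R L) :
  F \subset rsupp (weight x) ->
  rsupp (squeeze (weight x)) \subset (g |: rsupp (weight x))%SET.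
Proof.
move=> Fx; apply/fintype.subsetP => v; rewrite !inE /squeeze.
by case: (v == g) => //=; case: ifP => // /(fintype.subsetP Fx); rewrite inE.
Qed.

Lemma squeeze_id (x : realization R L) :
  ~~ (F \subset rsupp (weight x)) -> squeeze (weight x) = weight x.
Proof.
move=> /slack0 s0; apply/funext => v.
by rewrite /squeeze s0 mul0rn addr0 subr0 !if_same.
Qed.

Lemma squeezeP (x : realization R L) : realization_set R M (squeeze (weight x)).
Proof.
split=> [v||].
- rewrite /squeeze; case: ifP => _.
    by rewrite addr_ge0 ?mulrn_wge0 ?slack_ge0 // weight_ge0.
  by case: ifP => [vF|_]; rewrite ?subr_ge0 ?slack_le // weight_ge0.
- pose m := slack (weight x).
  have -> : squeeze (weight x) = fun v => weight x v +
      ((if v == g then m *+ #|F| else 0) + if v \in F then - m else 0).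
    apply/funext => v; rewrite /squeeze -/m; case: eqVneq => [->|_].
      by rewrite (negbTE Fg) addr0.
    by rewrite add0r; case: ifP => //; rewrite addr0.
  rewrite big_split /= [X in X + _](weight_sum x) big_split -!big_mkcond /= big_pred1_eq.
  by rewrite sumr_const mulNrn subrr addr0.
- rewrite /= -/(rsupp (squeeze (weight x))) defB.
  case: (boolP (F \subset rsupp (weight x))) => Fx; last first.
    by rewrite squeeze_id // Fx (weight_face x).
  rewrite (hA (FgA (weight_face x) Fx)) ?rsupp_squeeze //=.
  (* A vertex of [F] at which the minimum is attained loses all its weight, so [F] is no longer
     contained in the support. *)
  have [v vF sv] := slack_attained (weight x); apply/fintype.subsetPn.
  exists v => //; rewrite inE /squeeze vF -sv subrr; case: (eqVneq v g) => [vg|_].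
    by move: Fg; rewrite -vg vF.
  by rewrite eqxx.
Qed.

Definition collapse (x : realization R L) : realization R M :=
  rpoint (squeezeP x).

Lemma collapse_inclP (x : realization R M) : realization_set R L (weight x).
Proof.
have [x0 x1 xM] := weightP x; split=> //=.
by move: xM; rewrite /= defB => /andP[].
Qed.

Definition collapse_incl (x : realization R M) : realization R L :=
  rpoint (collapse_inclP x).

Lemma slack_continuous :
  continuous (fun x : realization R L => slack (weight x)).
Proof.
rewrite /slack; elim: (index_enum V) => [|v r IH].
  under eq_fun do rewrite big_nil.
  exact: (@weight_continuous R L f).
under eq_fun do rewrite big_cons.
case: (v \in F) => // x; apply: continuous_min; last exact: IH.
exact: (@weight_continuous R L v).
Qed.

Lemma collapse_continuous : continuous collapse.
Proof.
have cs := slack_continuous.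
apply: realization_continuous => v; rewrite /collapse.
under eq_fun do rewrite weight_rpoint /squeeze.
have cw := @weight_continuous R L v.
have ifb (b : bool) (h k : realization R L -> R) : continuous h ->
    continuous k -> continuous (fun x => if b then h x else k x) by case: b.
by apply: (ifb); [exact: continuous_addMn|apply: (ifb) => //; exact: continuous_subr].
Qed.

Lemma collapse_incl_continuous : continuous collapse_incl.
Proof.
by apply: realization_continuous => v; exact: (@weight_continuous R M v).
Qed.

(** No face of [M] contains [F], so [slack] vanishes there and [collapse] fixes [M] pointwise. In
    [L], a point and its image have their supports in the common face obtained by adding [g], and
    the straight homotopy applies. *)
Lemma collapse_equivalent :
  homotopy_equivalent R (realization R L) (realization R M).
Proof.
exists collapse, collapse_incl; split.
- exact: collapse_continuous.
- exact: collapse_incl_continuous.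
- apply: straight_homotopic => [x||x].
  + rewrite !weight_rpoint.
    case: (boolP (F \subset rsupp (weight x))) => Fx.
      apply: (hA (FgA (weight_face x) Fx)).
      by rewrite finset.subUset rsupp_squeeze //= finset.subsetUr.
    by rewrite squeeze_id // finset.setUid; exact: weight_face.
  + move=> x; apply: (@continuous_comp _ _ _ collapse).
      exact: collapse_continuous.
    exact: collapse_incl_continuous.
  + exact: cvg_id.
- have -> : collapse \o collapse_incl = id.
    apply/funext => x; apply: weight_inj.
    rewrite weight_rpoint squeeze_id ?weight_rpoint //.
    by have := weight_face x; rewrite /= defB => /andP[].
  by apply: homotopic_refl => x; exact: cvg_id.
Qed.

End Collapse.

(** * Equivalence of pointed complexes *)

Definition down_closed (V : finType) (P : {set V} -> bool) : Prop :=
  forall F G : {set V}, P F -> G \subset F -> P G.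

Lemma down_faces (V : finType) (P : {set V} -> bool) : down_closed P ->
  forall F G : {set V}, F \in [set S | P S]%SET -> G \subset F ->
    G \in [set S | P S]%SET.
Proof. by move=> dP F G; rewrite !inE; exact: dP. Qed.

Definition dcx (V : finType) (P : {set V} -> bool) (dP : down_closed P) : scomplex :=
  SComplex (down_faces dP).

Record pcx := PCx { cx : scomplex; base : ground cx;
                    base_face : [set base]%SET \in faces cx }.

Inductive pequiv : pcx -> pcx -> Prop :=
| pe_sym P Q : pequiv P Q -> pequiv Q P
| pe_trans P Q S : pequiv P Q -> pequiv Q S -> pequiv P S
| pe_iso P Q (f : ground (cx P) -> ground (cx Q)) :
    injective f -> f (base P) = base Q ->
    (forall S, S \in faces (cx P) -> (f @: S)%SET \in faces (cx Q)) ->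
    (forall T, T \in faces (cx Q) -> exists2 S, S \in faces (cx P) & T = (f @: S)%SET) ->
    pequiv P Q
| pe_base L p q (hp : [set p]%SET \in faces L) (hq : [set q]%SET \in faces L) :
    [set p; q]%SET \in faces L -> pequiv (PCx hp) (PCx hq)
(* The link of F is a cone with apex g: all the faces containing F go. *)
| pe_collapse V A B hA hB (F : {set V}) f g p
    (hp : [set p]%SET \in faces (@SComplex V A hA))
    (hp' : [set p]%SET \in faces (@SComplex V B hB)) :
    f \in F -> g \notin F ->
    (forall S, S \in A -> F \subset S -> (g |: S)%SET \in A) ->
    (forall S, (S \in B) = (S \in A) && ~~ (F \subset S)) ->
    pequiv (PCx hp) (PCx hp').

Lemma pequiv_realization (R : realType) P Q : pequiv P Q ->
  homotopy_equivalent R (realization R (cx P)) (realization R (cx Q)).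
Proof.
elim=> {P Q} [P Q _|P Q S _ + _|P Q f finj fb fP fQ|L p q *|V A B hA hB F f g p ? ?].
- exact: homotopy_equivalent_sym.
- exact: homotopy_equivalent_trans.
(* Ground elements of [Q] outside the image of [f] are not vertices, so the default value taken
   there is harmless. *)
- pose g w := odflt (base P) [pick v | f v == w].
  have fK : cancel f g.
    move=> v; rewrite /g; case: pickP => [u /eqP /finj //|/(_ v)].
    by rewrite eqxx.
  have gK w : [set w]%SET \in faces (cx Q) -> f (g w) = w.
    case/fQ => S _ /setP /(_ w); rewrite finset.in_set1 eqxx.
    by move=> /esym /imsetP[v _ ->]; rewrite fK.
  apply: (@homotopy_equivalent_push R _ _ f g) => // T /fQ[S SP ->].
  rewrite -imset_comp (_ : [set _ | _ in _]%SET = S) //.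
  by rewrite -[RHS]imset_id; apply: eq_imset => v /=; rewrite fK.
- exact: homotopy_equivalent_refl.
- move=> fF gF FgA defB; exact: (collapse_equivalent _ _ _ fF gF FgA defB).
Qed.

Lemma pequiv_eq (L M : scomplex) (f : ground L -> ground M) p q
    (hp : [set p]%SET \in faces L) (hq : [set q]%SET \in faces M) :
  injective f -> f p = q ->
  (forall S, S \in faces L -> (f @: S)%SET \in faces M) ->
  (forall T, T \in faces M -> exists2 S, S \in faces L & T = (f @: S)%SET) ->
  pequiv (PCx hp) (PCx hq).
Proof. by move=> *; apply: (@pe_iso (PCx hp) (PCx hq) f). Qed.

Lemma pequiv_ext (V : finType) (A B : {set {set V}}) hA hB (p : V)
    (hp : [set p]%SET \in faces (@SComplex V A hA))
    (hp' : [set p]%SET \in faces (@SComplex V B hB)) :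
  A =i B -> pequiv (PCx hp) (PCx hp').
Proof.
move=> AB; apply: (@pequiv_eq (SComplex hA) (SComplex hB) id p p hp hp') => //
  [S|S] /= SA.
  by rewrite imset_id -AB.
by exists S; rewrite ?imset_id ?AB.
Qed.

Lemma pequiv_refl P : pequiv P P.
Proof. by case: P => -[V A hA] p hp; apply: pequiv_ext. Qed.

(** The collapses are made one after the other. As no apex [g i] lies in any [F j], adding an apex
    to a face that contains no [F j] cannot create one, and the cone condition survives the removals
    already made. *)
Lemma pequiv_family (V : finType) (A B : {set {set V}}) hA hB (I : eqType)
    (s : seq I) (F : I -> {set V}) (g : I -> V) p
    (hp : [set p]%SET \in faces (@SComplex V A hA))
    (hp' : [set p]%SET \in faces (@SComplex V B hB)) :
  (forall i, i \in s -> F i != finset.set0) ->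
  (forall i j, i \in s -> j \in s -> g i \notin F j) ->
  (forall i S, i \in s -> S \in A -> F i \subset S -> (g i |: S)%SET \in A) ->
  (forall S, (S \in B) = (S \in A) && all (fun i => ~~ (F i \subset S)) s) ->
  pequiv (PCx hp) (PCx hp').
Proof.
elim: s B hB hp' => [|i s IH] B hB hp' F0 gF FgA defB.
  by apply: pequiv_ext => S; rewrite defB /= andbT.
pose C := [set S in A | all (fun i => ~~ (F i \subset S)) s]%SET.
have hC (S T : {set V}) : S \in C -> T \subset S -> T \in C.
  rewrite !inE => /andP[SA /allP Ss] TS; rewrite (hA _ _ SA TS) /=.
  by apply/allP => j /Ss; apply: contra => /fintype.subset_trans; apply.
have pC : [set p]%SET \in faces (SComplex hC).
  have /andP[pA /andP[_ ps]] := etrans (esym (defB _)) hp'.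
  by rewrite /= inE; apply/andP.
have is_ j : j \in s -> j \in i :: s by rewrite inE orbC => ->.
apply: (@pe_trans _ (PCx pC)).
  apply: IH => [j /is_ /F0 //|j k /is_ js /is_ ks|j S /is_|S]; [exact: gF|exact: FgA|].
  by rewrite inE.
have /finset.set0Pn[f fF] := F0 i (mem_head _ _).
apply: (@pe_collapse V C B hC hB (F i) f (g i)) => // [|S|S].
- by apply: gF; rewrite mem_head.
- rewrite !inE => /andP[SA /allP Ss] FS; rewrite FgA ?mem_head //=.
  apply/allP => j js; apply: contra (Ss _ js) => /fintype.subsetP Fj.
  apply/fintype.subsetP => x xF; have := Fj _ xF; rewrite in_setU1.
  by case/orP => // /eqP xg; have := gF i j (mem_head _ _) (is_ _ js); rewrite -xg xF.
- by rewrite defB inE /= -!andbA; congr (_ && _); exact: andbC.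
Qed.

(** The family to remove consists of the faces outside [B] that avoid [g]. By the last condition
    each face [S] outside [B] contains such a face, namely [S :\ g]. *)
Lemma pequiv_cone (V : finType) (A B : {set {set V}}) hA hB (g : V) p
    (hp : [set p]%SET \in faces (@SComplex V A hA))
    (hp' : [set p]%SET \in faces (@SComplex V B hB)) :
  B \subset A ->
  (forall S, S \in A -> S \notin B -> (g |: S)%SET \in A) ->
  (forall S, S \in A -> S \notin B -> (S :\ g)%SET \notin B) ->
  pequiv (PCx hp) (PCx hp').
Proof.
move=> BA gA gB.
pose s := enum [set F in A | (F \notin B) && (g \notin F)]%SET.
apply: (@pequiv_family V A B hA hB _ s id (fun=> g)) => [S|S T|S T|S].
- rewrite mem_enum inE => /and3P[_ SB _]; apply: contraNneq SB => ->.
  by apply: (hB _ _ hp'); exact: finset.sub0set.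
- by rewrite !mem_enum !inE => _ /and3P[].
- rewrite mem_enum inE => /and3P[SA SB gS] TA ST; apply: gA => //.
  by apply: contra SB => TB; exact: (hB _ _ TB).
- apply/idP/andP => [SB|[SA /allP Ss]].
    split; first exact: (fintype.subsetP BA).
    apply/allP => T; rewrite mem_enum inE => /and3P[_ TB _].
    by apply: contra TB; exact: (hB _ _ SB).
  apply: contraT => SB; have := Ss (S :\ g)%SET.
  rewrite mem_enum inE gB // !inE eqxx /= finset.subD1set andbT.
  by move=> /(_ (hA _ _ SA (finset.subD1set _ _))).
Qed.

(** * Attaching a suspension *)

Lemma pequiv_family_pred (V : finType) (P Q : {set V} -> bool)
    (dP : down_closed P) (dQ : down_closed Q) (I : eqType) (s : seq I) (F : I -> {set V})
    (g : I -> V) p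
    (hp : [set p]%SET \in faces (dcx dP)) (hp' : [set p]%SET \in faces (dcx dQ)) :
  (forall i, i \in s -> F i != finset.set0) ->
  (forall i j, i \in s -> j \in s -> g i \notin F j) ->
  (forall i S, i \in s -> P S -> F i \subset S -> P (g i |: S)%SET) ->
  (forall S, Q S = P S && all (fun i => ~~ (F i \subset S)) s) ->
  pequiv (PCx hp) (PCx hp').
Proof.
move=> F0 gF FgP defQ.
apply: (@pequiv_family _ _ _ _ _ _ s F g p hp hp') => // [i S|S].
  by rewrite !inE; exact: FgP.
by rewrite !inE defQ.
Qed.

(* A set of vertices of V + option U is handled through the triple (F, G, q) of
   its traces on V and on U and of its membership of the vertex inr None. *)
Section Triples.
Variables V U : finType.
Implicit Types (S T : {set V + option U}) (P : {set V} -> {set U} -> bool -> bool).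

Definition lpart S : {set V} := [set x | inl x \in S]%SET.
Definition xpart S : {set U} := [set x | inr (Some x) \in S]%SET.
Definition qpart S : bool := inr None \in S.

Lemma lpart_l a S : lpart (inl a |: S)%SET = (a |: lpart S)%SET.
Proof. by apply/setP => x; rewrite !inE. Qed.
Lemma xpart_l a S : xpart (inl a |: S)%SET = xpart S.
Proof. by apply/setP => x; rewrite !inE. Qed.
Lemma qpart_l a S : qpart (inl a |: S)%SET = qpart S.
Proof. by rewrite /qpart !inE. Qed.
Lemma lpart_x a S : lpart (inr (Some a) |: S)%SET = lpart S.
Proof. by apply/setP => x; rewrite !inE. Qed.
Lemma xpart_x a S : xpart (inr (Some a) |: S)%SET = (a |: xpart S)%SET.
Proof. by apply/setP => x; rewrite !inE. Qed.
Lemma qpart_x a S : qpart (inr (Some a) |: S)%SET = qpart S.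
Proof. by rewrite /qpart !inE. Qed.
Lemma lpart_q S : lpart (inr None |: S)%SET = lpart S.
Proof. by apply/setP => x; rewrite !inE. Qed.
Lemma xpart_q S : xpart (inr None |: S)%SET = xpart S.
Proof. by apply/setP => x; rewrite !inE. Qed.
Lemma qpart_q S : qpart (inr None |: S)%SET.
Proof. by rewrite /qpart !inE eqxx. Qed.
Lemma lpart0 : lpart finset.set0 = finset.set0.
Proof. by apply/setP => x; rewrite !inE. Qed.
Lemma xpart0 : xpart finset.set0 = finset.set0.
Proof. by apply/setP => x; rewrite !inE. Qed.
Lemma qpart0 : qpart finset.set0 = false.
Proof. by rewrite /qpart inE. Qed.
Lemma lpart1l a : lpart [set inl a]%SET = [set a]%SET.
Proof. by apply/setP => x; rewrite !inE. Qed.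
Lemma xpart1l a : xpart [set inl a]%SET = finset.set0.
Proof. by apply/setP => x; rewrite !inE. Qed.
Lemma qpart1l a : qpart [set inl a]%SET = false.
Proof. by rewrite /qpart inE. Qed.

Definition partE := (lpart_l, xpart_l, qpart_l, lpart_x, xpart_x, qpart_x,
  lpart_q, xpart_q, qpart_q, lpart0, xpart0, qpart0, lpart1l, xpart1l, qpart1l).

Lemma part_sub S T : S \subset T ->
  [/\ lpart S \subset lpart T, xpart S \subset xpart T & qpart S -> qpart T].
Proof.
move=> /fintype.subsetP ST.
by split; [apply/fintype.subsetP => x|apply/fintype.subsetP => x|];
  rewrite ?inE; exact: ST.
Qed.

Lemma part_inj S T :
  lpart S = lpart T -> xpart S = xpart T -> qpart S = qpart T -> S = T.
Proof.
move=> /setP l /setP x q; apply/setP => -[a|[a|]]; last exact: q.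
- by have := l a; rewrite !inE.
- by have := x a; rewrite !inE.
Qed.

Definition monotone3 P := forall (F F' : {set V}) (G G' : {set U}) (q q' : bool),
  P F G q -> F' \subset F -> G' \subset G -> (q' -> q) -> P F' G' q'.

Definition tri P S := P (lpart S) (xpart S) (qpart S).

Lemma tri_down P : monotone3 P -> down_closed (tri P).
Proof. by move=> mP S T PS /part_sub[l x q]; exact: mP PS l x q. Qed.

Lemma tri_face1 P (mP : monotone3 P) a :
  P [set a]%SET finset.set0 false -> [set (inl a)]%SET \in faces (dcx (tri_down mP)).
Proof. by rewrite /= inE /tri !partE. Qed.

Definition tcx P (mP : monotone3 P) a (h : P [set a]%SET finset.set0 false) : pcx :=
  PCx (tri_face1 mP h).

End Triples.

Lemma all_notinP (T : finType) (A : {set T}) :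
  all (fun x => x \notin A) (enum T) = (A == finset.set0).
Proof.
apply/allP/eqP => [A0|-> x _]; last by rewrite inE.
by apply/setP => x; rewrite inE; apply: negbTE; apply: A0; rewrite mem_enum.
Qed.

Section Attach.
Variables (L : scomplex) (p : ground L) (hp : [set p]%SET \in faces L).
Variable X : scomplex.

(* The suspension of X with poles p and inr None, glued to L at p. *)
Definition att_pred (F : {set ground L}) (G : {set ground X}) (q : bool) : bool :=
  if q || (G != finset.set0)
  then [&& F \subset [set p]%SET, G \in faces X & ~~ (q && (p \in F))]
  else F \in faces L.

Lemma att_mono : monotone3 att_pred.
Proof.
move=> F F' G G' q q' + FF' GG' qq'; rewrite /att_pred.
case: ifP => [_ /and3P[Fp GX qF]|/norP[/negP qF]].
  have F'p := fintype.subset_trans FF' Fp.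
  case: ifP => _; last exact: faces_sub hp F'p.
  rewrite F'p (faces_sub GX GG') /=; apply: contra qF => /andP[/qq' -> pF'].
  exact: (fintype.subsetP FF').
rewrite negbK => /eqP G0 FL; rewrite ifF; first exact: faces_sub FL FF'.
move: GG'; rewrite G0 finset.subset0 => ->; rewrite orbF.
by apply/negP => /qq' /qF.
Qed.

Lemma att_base : att_pred [set p]%SET finset.set0 false.
Proof. by rewrite /att_pred /= eqxx. Qed.

Definition att := tcx att_mono att_base.

End Attach.

Definition Att (P : pcx) (X : scomplex) : pcx := att (base_face P) X.

Section TripleSet.
Variables V U : finType.

Definition tset (F : {set V}) (G : {set U}) (q : bool) : {set V + option U} :=
  [set z | match z with
           | inl a => a \in F | inr (Some x) => x \in G | inr None => q end]%SET.

Lemma lpart_tset F G q : lpart (tset F G q) = F.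
Proof. by apply/setP => a; rewrite !inE. Qed.

Lemma xpart_tset F G q : xpart (tset F G q) = G.
Proof. by apply/setP => a; rewrite !inE. Qed.

Lemma qpart_tset F G q : qpart (tset F G q) = q.
Proof. by rewrite /qpart inE. Qed.

Definition tsetE := (lpart_tset, xpart_tset, qpart_tset).

Lemma tset_sub F G q (S : {set V + option U}) : (tset F G q \subset S) =
  [&& F \subset lpart S, G \subset xpart S & q ==> qpart S].
Proof.
apply/fintype.subsetP/and3P => [FS|[/fintype.subsetP l /fintype.subsetP x q']].
  split; first by apply/fintype.subsetP => a aF; rewrite inE FS // inE.
    by apply/fintype.subsetP => a aF; rewrite inE FS // inE.
  by apply/implyP => qq; apply: FS; rewrite inE.
case=> [a|[a|]]; rewrite inE => z; last exact: implyP q' z.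
- by have := l _ z; rewrite inE.
- by have := x _ z; rewrite inE.
Qed.

End TripleSet.

Lemma pequiv_tri_family (V U : finType) (P Q : {set V} -> {set U} -> bool -> bool)
    (mP : monotone3 P) (mQ : monotone3 Q) (I : eqType) (s : seq I)
    (F : I -> {set V}) (G : I -> {set U}) (q : I -> bool)
    (g : I -> V + option U) p
    (hp : P [set p]%SET finset.set0 false) (hq : Q [set p]%SET finset.set0 false) :
  (forall i, i \in s -> tset (F i) (G i) (q i) != finset.set0) ->
  (forall i j, i \in s -> j \in s -> g i \notin tset (F j) (G j) (q j)) ->
  (forall i S, i \in s -> P (lpart S) (xpart S) (qpart S) ->
     F i \subset lpart S -> G i \subset xpart S -> q i ==> qpart S ->
     P (lpart (g i |: S)%SET) (xpart (g i |: S)%SET) (qpart (g i |: S)%SET)) ->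
  (forall A B b, Q A B b = P A B b &&
     all (fun i => ~~ [&& F i \subset A, G i \subset B & q i ==> b]) s) ->
  pequiv (tcx mP hp) (tcx mQ hq).
Proof.
move=> F0 gF FgP defQ.
apply: (@pequiv_family_pred _ _ _ _ _ _ s (fun i => tset (F i) (G i) (q i)) g) => //.
  by move=> i S si PS; rewrite tset_sub => /and3P[*]; exact: FgP.
move=> S; rewrite /tri defQ; congr (_ && _).
by apply: eq_all => i; rewrite tset_sub.
Qed.

Lemma subset1_notin (T : finType) (F : {set T}) x :
  (F \subset [set x]%SET) && (x \notin F) = (F == finset.set0).
Proof.
rewrite finset.subset1; apply/andP/eqP => [[/orP[]/eqP -> //]|->].
  by rewrite inE eqxx.
by rewrite eqxx orbT inE.
Qed.

Lemma pequiv_tri_ext (V U : finType) (P Q : {set V} -> {set U} -> bool -> bool)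
    (mP : monotone3 P) (mQ : monotone3 Q) p
    (hp : P [set p]%SET finset.set0 false) (hq : Q [set p]%SET finset.set0 false) :
  (forall A B b, P A B b = Q A B b) -> pequiv (tcx mP hp) (tcx mQ hq).
Proof. by move=> PQ; apply: pequiv_ext => S; rewrite !inE /tri PQ. Qed.

Section AttachIso.
Variables (V V' U U' : finType) (f : V -> V') (h : U -> U').

Definition tmap (z : V + option U) : V' + option U' :=
  match z with inl a => inl (f a) | inr (Some x) => inr (Some (h x))
  | inr None => inr None end.

Lemma tmap_inj : injective f -> injective h -> injective tmap.
Proof.
by move=> fi hi [a|[x|]] [b|[y|]] //= [] => [/fi->|/hi->].
Qed.

Lemma lpart_tmap (S : {set V + option U}) : lpart (tmap @: S)%SET = (f @: lpart S)%SET.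
Proof.
apply/setP => b; rewrite inE; apply/imsetP/imsetP => [[[a|[x|]] // aS [->]]|[a]].
  by exists a; rewrite ?inE.
by rewrite inE => aS ->; exists (inl a).
Qed.

Lemma xpart_tmap (S : {set V + option U}) : xpart (tmap @: S)%SET = (h @: xpart S)%SET.
Proof.
apply/setP => b; rewrite inE; apply/imsetP/imsetP => [[[a|[x|]] // aS [->]]|[a]].
  by exists x; rewrite ?inE.
by rewrite inE => aS ->; exists (inr (Some a)).
Qed.

Lemma qpart_tmap (S : {set V + option U}) : qpart (tmap @: S)%SET = qpart S.
Proof.
by apply/imsetP/idP => [[[a|[x|]]]//|qS]; exists (inr None).
Qed.

End AttachIso.

Definition embeds (L M : scomplex) (f : ground L -> ground M) :=
  [/\ injective f,
    forall S, S \in faces L -> (f @: S)%SET \in faces M &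
    forall T, T \in faces M -> exists2 S, S \in faces L & T = (f @: S)%SET].

Lemma att_iso L M (f : ground L -> ground M) X Y (h : ground X -> ground Y) p q
    (hp : [set p]%SET \in faces L) (hq : [set q]%SET \in faces M) :
  embeds f -> embeds h -> f p = q -> pequiv (att hp X) (att hq Y).
Proof.
move=> [fi fL fM] [hi hX hY] fp.
apply: (@pe_iso (att hp X) (att hq Y) (tmap f h)) => [||S|T]; first exact: tmap_inj.
- by rewrite /= fp.
- rewrite !inE /tri lpart_tmap xpart_tmap qpart_tmap /att_pred imset_eq0.
  case: ifP => _; last exact: fL.
  case/and3P=> Sp SX qS; rewrite hX //= -fp mem_imset //= qS andbT.
  by rewrite -imset_set1 imsetS.
- rewrite !inE /tri /att_pred; case: ifP => [qG /and3P[Tq /hY[G GX TG] qT]|].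
    have [F TF Fp] : exists2 F : {set ground L}, lpart T = (f @: F)%SET & F \subset [set p]%SET.
      move: Tq; rewrite finset.subset1 => /orP[]/eqP ->.
        by exists [set p]%SET; rewrite ?imset_set1 ?fp.
      by exists finset.set0; rewrite ?imset0 ?finset.sub0set.
    exists (tset F G (qpart T)).
      rewrite !inE /tri !tsetE /att_pred; move: qG; rewrite TG imset_eq0 => ->.
      by rewrite Fp GX; move: qT; rewrite TF -fp mem_imset.
    apply: (@part_inj (ground M) (ground Y) T (tmap f h @: tset F G (qpart T))%SET);
    by rewrite ?lpart_tmap ?xpart_tmap ?qpart_tmap tsetE.
  move=> /norP[/negbTE qT]; rewrite negbK => /eqP xT /fM[F FL TF].
  exists (tset F finset.set0 false).
    by rewrite !inE /tri !tsetE /att_pred /= eqxx.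
  apply: (@part_inj (ground M) (ground Y) T (tmap f h @: tset F finset.set0 false)%SET);
  by rewrite ?lpart_tmap ?xpart_tmap ?qpart_tmap tsetE ?imset0.
Qed.

Lemma embeds_id L : embeds (@id (ground L)).
Proof.
split=> // [S|S] SL; first by rewrite imset_id.
by exists S; rewrite ?imset_id.
Qed.

(** Since [[set p]] survives in [B], [F] is not contained in it. Hence no face that meets the
    suspension away from [p] contains [F], and the apex [g] serves as before. *)
Lemma att_collapse_l V A B hA hB (F : {set V}) f g p
    (hp : [set p]%SET \in faces (@SComplex V A hA))
    (hp' : [set p]%SET \in faces (@SComplex V B hB)) X :
  f \in F -> g \notin F ->
  (forall S, S \in A -> F \subset S -> (g |: S)%SET \in A) ->
  (forall S, (S \in B) = (S \in A) && ~~ (F \subset S)) ->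
  pequiv (att hp X) (att hp' X).
Proof.
move=> fF gF FgA defB.
have Fp : ~~ (F \subset [set p]%SET).
  by have := hp'; rewrite [_ \in _]defB => /andP[].
apply: (@pequiv_tri_family _ _ _ _ _ _ unit [:: tt] (fun=> F)
  (fun=> finset.set0) (fun=> false) (fun=> inl g)) => [i _|i j _ _|i S _|S G b].
- by apply/finset.set0Pn; exists (inl f); rewrite inE.
- by rewrite inE.
- rewrite /att_pred !partE => + FS _ _; case: ifP => [_ /and3P[Sp]|_ SA].
    by rewrite (fintype.subset_trans FS Sp) in Fp.
  exact: FgA.
- rewrite /att_pred /= finset.sub0set !andbT; case: ifP => // _.
  case: (boolP (S \subset [set p]%SET)) => //= Sp.
  have /negbTE -> : ~~ (F \subset S).
    by apply: contra Fp => FS; exact: fintype.subset_trans FS Sp.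
  by rewrite andbT.
Qed.

(** As [F] is not empty, the faces containing its copy all lie in the suspension, where the copy of
    [g] is an apex whichever pole is present. *)
Lemma att_collapse_r (V : finType) (A B : {set {set V}}) hA hB (F : {set V}) f g P :
  f \in F -> g \notin F ->
  (forall S, S \in A -> F \subset S -> (g |: S)%SET \in A) ->
  (forall S, (S \in B) = (S \in A) && ~~ (F \subset S)) ->
  pequiv (Att P (@SComplex V A hA)) (Att P (@SComplex V B hB)).
Proof.
move=> fF gF FgA defB.
apply: (@pequiv_tri_family _ _ _ _ _ _ unit [:: tt] (fun=> finset.set0)
  (fun=> F) (fun=> false) (fun=> inr (Some g))) => [i _|i j _ _|i S _|S G b].
- by apply/finset.set0Pn; exists (inr (Some f)); rewrite inE.
- by rewrite inE.
- have SF0 : F \subset xpart S -> xpart S != finset.set0.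
    by move=> /fintype.subsetP/(_ _ fF) fS; apply/finset.set0Pn; exists f.
  rewrite /att_pred !partE => + _ FS _; rewrite SF0 // orbT => /and3P[-> /= SA ->].
  by rewrite FgA // (_ : (g |: xpart S != finset.set0)%SET) ?orbT //;
    apply/finset.set0Pn; exists g; rewrite !inE eqxx.
- rewrite /att_pred /= finset.sub0set !andbT; case: ifP => [_|]; last first.
    case/norP => _; rewrite negbK => /eqP ->; rewrite finset.subset0.
    rewrite (_ : F == _ = false) ?andbT //.
    by apply/negP => /eqP F0; rewrite F0 inE in fF.
  by rewrite defB -!andbA; congr (_ && _); congr (_ && _); exact: andbC.
Qed.

(* Both attachments are obtained by collapsing the complex in which the lower
   cone of X is coned off by the whole edge {p, q}. *)
Section Slide.
Variables (L : scomplex) (p q : ground L).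
Hypotheses (hp : [set p]%SET \in faces L) (hq : [set q]%SET \in faces L).
Hypothesis pq : [set p; q]%SET \in faces L.
Variable X : scomplex.

Definition slide_pred (F : {set ground L}) (G : {set ground X}) (b : bool) : bool :=
  if b || (G != finset.set0)
  then [&& F \subset [set p; q]%SET, G \in faces X & b ==> (F == finset.set0)]
  else F \in faces L.

Lemma slide_mono : monotone3 slide_pred.
Proof.
move=> F F' G G' b b' + FF' GG' bb'; rewrite /slide_pred.
case: ifP => [_ /and3P[Fp GX qF]|/norP[/negP qF]].
  have F'p := fintype.subset_trans FF' Fp.
  case: ifP => _; last exact: faces_sub pq F'p.
  rewrite F'p (faces_sub GX GG') /=; apply/implyP => /bb' bT.
  by move: qF FF'; rewrite bT /= => /eqP ->; rewrite finset.subset0.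
rewrite negbK => /eqP G0 FL; rewrite ifF; first exact: faces_sub FL FF'.
move: GG'; rewrite G0 finset.subset0 => ->; rewrite orbF.
by apply/negP => /bb' /qF.
Qed.

Lemma slide_base : slide_pred [set p]%SET finset.set0 false.
Proof. by rewrite /slide_pred /= eqxx. Qed.

(** For each vertex [x] of [X], the link of the edge from [q] to [x] is a cone with apex [p].
    Removing all these edges leaves the lower cone with the single apex [p]. *)
Lemma slide_collapse : p != q -> pequiv (tcx slide_mono slide_base) (att hp X).
Proof.
move=> pNq.
apply: (@pequiv_tri_family _ _ _ _ _ _ (ground X) (enum (ground X)) (fun=> [set q]%SET)
  (fun x => [set x]%SET) (fun=> false) (fun=> inl p)) => [x _|x y _ _|x S _|F G b].
- by apply/finset.set0Pn; exists (inl q); rewrite !inE.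
- by rewrite !inE.
- rewrite /slide_pred !partE !finset.sub1set => + qS xS _.
  have -> : xpart S != finset.set0 by apply/finset.set0Pn; exists x.
  rewrite orbT => /and3P[Spq -> bS]; rewrite finset.subUset Spq finset.sub1set !inE eqxx /=.
  rewrite (_ : qpart S = false) //; apply/negP => b.
  by move: bS qS; rewrite b /= => /eqP ->; rewrite inE.
- have -> : all (fun i => ~~ [&& [set q]%SET \subset F, [set i]%SET \subset G & false ==> b])
      (enum (ground X)) = (q \notin F) || (G == finset.set0).
    rewrite -all_notinP; case: (boolP (q \in F)) => qF /=.
      by apply: eq_all => x; rewrite !finset.sub1set qF /= andbT.
    by apply/allP => x _; rewrite finset.sub1set (negbTE qF).
  have Fpq : (F \subset [set p]%SET) = (F \subset [set p; q]%SET) && (q \notin F).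
    apply/idP/andP => [Fp|[/fintype.subsetP Fpq qF]].
      split; first by rewrite (fintype.subset_trans Fp) // finset.sub1set !inE eqxx.
      apply: contra pNq => /(fintype.subsetP Fp); rewrite inE eq_sym //.
    apply/fintype.subsetP => x xF; have := Fpq _ xF; rewrite !inE => /orP[//|].
    by move=> /eqP xq; rewrite -xq xF in qF.
  rewrite /slide_pred /att_pred; case: (eqVneq G finset.set0) => [->|G0].
    rewrite orbF orbT andbT; case: b => //=.
    rewrite andbCA subset1_notin andbCA; congr (_ && _).
    by case: eqP => [->|]; rewrite ?andbF ?finset.sub0set.
  rewrite orbT orbF Fpq; case: b => /=; last first.
    by rewrite !andbT -!andbA; congr (_ && _); exact: andbC.
  rewrite -Fpq andbCA subset1_notin; case: eqP => [->|]; last by rewrite !andbF.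
  by rewrite finset.sub0set inE !andbT.
Qed.

End Slide.

Lemma att_slide L p q (hp : [set p]%SET \in faces L) (hq : [set q]%SET \in faces L) X :
  [set p; q]%SET \in faces L -> pequiv (att hp X) (att hq X).
Proof.
move=> pq; case: (eqVneq p q) => [pq'|pNq].
  by subst q; rewrite (bool_irrelevance hp hq); exact: pequiv_refl.
have qp : [set q; p]%SET \in faces L by rewrite finset.setUC.
apply: pe_trans (pe_sym (slide_collapse hp pq X pNq)) _.
apply: pe_trans (slide_collapse hq qp X _); last by rewrite eq_sym.
(* Exchanging [p] and [q] gives the same slide complex, with the base point at the other end of the
   edge. *)
have SE F G b : slide_pred (X := X) p q F G b = slide_pred q p F G b.
  by rewrite /slide_pred (finset.setUC [set p]%SET).
have ext : pequiv (tcx (slide_mono pq (X := X)) (slide_base q hp X))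
    (tcx (slide_mono qp (X := X)) (etrans (esym (SE _ _ _)) (slide_base q hp X))).
  exact: pequiv_tri_ext.
apply: pe_trans ext _; apply: pe_base.
rewrite /= inE /tri.
rewrite (_ : [set inl p; inl q]%SET = (inl p |: [set inl q])%SET) // !partE.
by rewrite /slide_pred /= eqxx.
Qed.

(** Induction on the derivation. The move of the base point is the case that needs [att_slide]: the
    pole of the attached suspension has to follow. *)
Lemma Att_congr_l P Q X : pequiv P Q -> pequiv (Att P X) (Att Q X).
Proof.
elim=> {P Q} [P Q _|P Q S _ + _|[L p hp] [M q hq] f fi fb fP fQ|L p q hp hq pq|].
- exact: pe_sym.
- exact: pe_trans.
- by apply: (@att_iso L M f X X id p q hp hq); [split|exact: embeds_id|exact: fb].
- have hpq : [set inl p; inl q]%SET \in faces (cx (att hq X)).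
    rewrite /= inE /tri.
    rewrite (_ : [set inl p; inl q]%SET = (inl p |: [set inl q])%SET) // !partE.
    by rewrite /att_pred /= eqxx.
  exact: att_slide.
- by move=> V A B hA hB F f g p hp hp' *; apply: (@att_collapse_l _ _ _ _ _ F f g).
Qed.

(** Only the complex under [Q] is attached, so a move of its base point gives an identical
    attachment; a collapse is performed inside the suspension. *)
Lemma Att_congr_r P Q Q' : pequiv Q Q' -> pequiv (Att P (cx Q)) (Att P (cx Q')).
Proof.
elim=> {Q Q'} [Q Q' _|Q Q' S _ + _|Q Q' f fi fb fP fQ|L p q *|].
- exact: pe_sym.
- exact: pe_trans.
- apply: (@att_iso (cx P) (cx P) id (cx Q) (cx Q') f); [exact: embeds_id|by split|by []].
- exact: pequiv_refl.
- by move=> V A B hA hB F f g p hp hp' *; apply: (@att_collapse_r _ _ _ _ _ F f g).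
Qed.

Lemma Att_embeds P X Y (h : ground X -> ground Y) :
  embeds h -> pequiv (Att P X) (Att P Y).
Proof.
move=> eh; apply: (@att_iso (cx P) (cx P) id X Y h); [exact: embeds_id|exact: eh|by []].
Qed.

(** * Vertex deletion as the attachment of a suspended link *)

Section LinkDeletion.
Variables (Z : scomplex) (v : ground Z).

Lemma del_down : @down_closed (ground Z) (fun F => (v \notin F) && (F \in faces Z)).
Proof.
move=> F G /andP[vF FZ] GF; rewrite (faces_sub FZ GF) andbT.
by apply: contra vF; exact: (fintype.subsetP GF).
Qed.

Definition del := dcx del_down.

Lemma lk_down : @down_closed (ground Z) (fun F => (v \notin F) && ((v |: F)%SET \in faces Z)).
Proof.
move=> F G /andP[vF FZ] GF; rewrite (faces_sub FZ (finset.setUS _ GF)) andbT.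
by apply: contra vF; exact: (fintype.subsetP GF).
Qed.

Definition lk := dcx lk_down.

Lemma mem_del F : (F \in faces del) = (v \notin F) && (F \in faces Z).
Proof. by rewrite inE. Qed.

Lemma mem_lk F : (F \in faces lk) = (v \notin F) && ((v |: F)%SET \in faces Z).
Proof. by rewrite inE. Qed.

End LinkDeletion.

(* If the star of w contains the link of v, then the inclusion of the link of v
   into the deletion of v is null-homotopic, so that adding the vertex v amounts
   to attaching at w a suspension of its link.  The proof doubles the vertices
   of the link: a face of the doubled complex is a pair (F, G) of a set of
   vertices and of a set of copies of vertices, with F :|: G in the link. *)
Section ConeAttach.
Variables (Z : scomplex) (v w : ground Z).
Hypothesis vw : v != w.
Hypothesis link_star : forall F : {set ground Z}, v \notin F -> (v |: F)%SET \in faces Z ->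
  (w |: F)%SET \in faces Z.
Hypotheses (hw : [set w]%SET \in faces Z) (hw' : [set w]%SET \in faces (del v)).

Let A (F : {set ground Z}) := F \in faces (lk v).
Let B (F : {set ground Z}) := F \in faces (del v).

Let A_sub (F F' : {set ground Z}) : A F -> F' \subset F -> A F'. Proof. exact: faces_sub. Qed.
Let B_sub (F F' : {set ground Z}) : B F -> F' \subset F -> B F'. Proof. exact: faces_sub. Qed.

(** This is where the hypothesis on stars enters: [w] may be added to any face of the link of [v]
    without leaving the deletion. *)
Lemma lk_minus_del F : A (F :\ w)%SET -> B F.
Proof.
rewrite /A /B mem_del mem_lk !inE vw /= => /andP[vF vFZ].
rewrite vF; apply: faces_sub (link_star _ vFZ) _; first by rewrite !inE vw.
by apply/fintype.subsetP => x; rewrite !inE => ->; rewrite andbT orbN.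
Qed.

Lemma lk_del F : A F -> B F.
Proof. by move=> AF; apply: lk_minus_del; exact: faces_sub AF (finset.subD1set _ _). Qed.

(** [Z] itself in the form of triples: [v] becomes [inr None], and no copy is a vertex yet. *)
Definition single_pred (F G : {set ground Z}) (q : bool) :=
  (G == finset.set0) && (if q then A F else B F).

Lemma single_mono : monotone3 single_pred.
Proof.
move=> F F' G G' q q' /andP[/eqP-> FZ] FF' + qq'.
rewrite finset.subset0 /single_pred => -> /=; case: ifP => [/qq'|_].
  by move: FZ; case: q {qq'} => // AF _; exact: A_sub AF FF'.
suff BF : B F by exact: B_sub BF FF'.
by move: FZ; case: ifP => // _; exact: lk_del.
Qed.

Lemma single_base : single_pred [set w]%SET finset.set0 false.
Proof. by rewrite /single_pred eqxx. Qed.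

(** The doubled link, glued to the deletion along the original vertices and coned off by [v]. Taking
    [w] out of [F] in the last clause makes [w] a second apex over the doubled link, as [half_att]
    requires. *)
Definition double_pred (F G : {set ground Z}) (q : bool) :=
  if q then A (F :|: G)%SET
  else B F && (G == finset.set0) || A ((F :\ w) :|: G)%SET.

Lemma double_mono : monotone3 double_pred.
Proof.
move=> F F' G G' q q' + FF' GG' qq'; rewrite /double_pred.
have UU : (F' :|: G' \subset F :|: G)%SET by rewrite finset.setUSS.
have DD : ((F' :\ w) :|: G' \subset (F :\ w) :|: G)%SET.
  by rewrite finset.setUSS ?finset.setSD.
have DU : ((F :\ w) :|: G \subset F :|: G)%SET.
  by rewrite finset.setUSS ?finset.subD1set.
case: ifP => [_ AFG|/negbT qF].
  case: ifP => _; first exact: A_sub AFG UU.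
  by apply/orP; right; apply: A_sub AFG (fintype.subset_trans DD DU).
rewrite ifF; last by apply/negbTE; apply: contra qF.
case/orP => [/andP[BF /eqP G0]|AFG].
  by move: GG'; rewrite G0 finset.subset0 => ->; rewrite (B_sub BF FF').
by apply/orP; right; apply: A_sub AFG DD.
Qed.

Lemma double_base : double_pred [set w]%SET finset.set0 false.
Proof. by rewrite /double_pred eqxx andbT /B hw'. Qed.

(** Here [v] cones off the copies alone, which turns it into the free pole of the suspension to be
    attached. *)
Definition half_pred (F G : {set ground Z}) (q : bool) :=
  if q then (F == finset.set0) && A G else double_pred F G false.

Lemma half_mono : monotone3 half_pred.
Proof.
move=> F F' G G' q q' + FF' GG' qq'; rewrite /half_pred.
case: ifP => [_ /andP[/eqP F0 AG]|/negbT qF].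
  move: FF'; rewrite F0 finset.subset0 => F'0.
  rewrite (A_sub AG GG') andbT F'0; case: ifP => // _.
  move/eqP: F'0 => ->; rewrite /double_pred finset.set0D finset.set0U.
  by rewrite (A_sub AG GG') orbT.
rewrite ifF; last by apply/negbTE; apply: contra qF.
by move=> dFG; apply: double_mono dFG FF' GG' _.
Qed.

Lemma half_base : half_pred [set w]%SET finset.set0 false.
Proof. exact: double_base. Qed.

Lemma cone_single : pequiv (PCx hw) (tcx single_mono single_base).
Proof.
pose f x : ground Z + option (ground Z) := if x == v then inr None else inl x.
have fi : injective f.
  move=> x y; rewrite /f; case: eqVneq => [->|xv]; case: eqVneq => [->|yv] //.
  by case.
have lf (S : {set ground Z}) : lpart (f @: S)%SET = (S :\ v)%SET.
  apply/setP => x; rewrite !inE; apply/imsetP/andP => [[y yS]|[xv xS]].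
    by rewrite /f; case: eqVneq => // yv [->].
  by exists x; rewrite // /f (negbTE xv).
have xf (S : {set ground Z}) : xpart (f @: S)%SET = finset.set0.
  apply/setP => x; rewrite !inE; apply/imsetP => -[y yS].
  by rewrite /f; case: ifP.
have qf (S : {set ground Z}) : qpart (f @: S)%SET = (v \in S).
  apply/imsetP/idP => [[y yS]|vS]; last by exists v; rewrite // /f eqxx.
  by rewrite /f; case: eqVneq => [<-|].
apply: (@pe_iso (PCx hw) (tcx single_mono single_base) f) => // [|S SZ|T].
- by rewrite /= /f eq_sym (negbTE vw).
- rewrite inE /tri /single_pred lf xf qf eqxx /=; case: ifP => vS.
    by rewrite /A mem_lk !inE eqxx /= finset.setD1K.
  rewrite /B mem_del !inE eqxx /=; exact: faces_sub SZ (finset.subD1set _ _).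
- rewrite inE /tri /single_pred => /andP[/eqP T0 TZ].
  pose S := (if qpart T then v |: lpart T else lpart T)%SET.
  have [vT SZ] : v \notin lpart T /\ S \in faces Z.
    by move: TZ; rewrite /S; case: ifP => _; rewrite /A /B ?mem_lk ?mem_del => /andP[].
  exists S => //; apply: (@part_inj _ _ T (f @: S)%SET).
  + rewrite lf /S; case: ifP => _; first by rewrite finset.setU1K.
    by apply/esym/finset.setDidPl; rewrite disjoint_sym disjoints1.
  + by rewrite T0 xf.
  + by rewrite qf /S; case: ifP => _; [rewrite in_setU1 eqxx|rewrite (negbTE vT)].
Qed.

(** Each original vertex dominates its copy, so all the copies can be removed. *)
Lemma double_single :
  pequiv (tcx double_mono double_base) (tcx single_mono single_base).
Proof.
apply: (@pequiv_tri_family _ _ _ _ _ _ (ground Z) (enum (ground Z)) (fun=> finset.set0)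
  (fun x => [set x]%SET) (fun=> false) inl) => [x _|x y _ _|x S _|F G b].
- by apply/finset.set0Pn; exists (inr (Some x)); rewrite !inE.
- by rewrite !inE.
- rewrite /double_pred !partE finset.sub1set => + _ xS _.
  have xU : ([set x] :|: (lpart S :|: xpart S) = lpart S :|: xpart S)%SET.
    by apply/finset.setUidPr; rewrite finset.sub1set finset.in_setU xS orbT.
  rewrite -finset.setUA xU.
  case: ifP => // _ /orP[/andP[_ /eqP S0]|ASS].
    by rewrite S0 inE in xS.
  apply/orP; right; apply: A_sub ASS _; apply/fintype.subsetP => y.
  rewrite !finset.in_setU !finset.in_setD finset.in_setU1.
  by case: (eqVneq y x) => [->|]; rewrite ?xS ?orbT.
- under eq_all do rewrite finset.sub0set andbT finset.sub1set /=.
  rewrite all_notinP /single_pred andbC; case: (eqVneq G finset.set0) => [->|];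
    last by rewrite !andbF.
  rewrite /double_pred !finset.setU0 eqxx !andbT; case: b => //.
  by apply/idP/orP => [|[//|/lk_minus_del//]]; left.
Qed.

(** In the other direction, the link of the edge from [v] to an original vertex [x] is a cone with
    apex the copy of [x]; these edges are removed. *)
Lemma double_half : pequiv (tcx double_mono double_base) (tcx half_mono half_base).
Proof.
apply: (@pequiv_tri_family _ _ _ _ _ _ (ground Z) (enum (ground Z)) (fun x => [set x]%SET)
  (fun=> finset.set0) (fun=> true) (fun x => inr (Some x))) => [x _|x y _ _|x S _|F G b].
- by apply/finset.set0Pn; exists (inl x); rewrite !inE.
- by rewrite !inE.
- rewrite /double_pred !partE finset.sub1set => + xS _ /= qS; rewrite qS.
  rewrite finset.setUCA (_ : ([set x] :|: _ = lpart S :|: xpart S)%SET) //.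
  by apply/finset.setUidPr; rewrite finset.sub1set finset.in_setU xS.
- rewrite /half_pred; case: b => /=.
    under eq_all do rewrite finset.sub0set finset.sub1set /= andbT.
    rewrite all_notinP /double_pred andbC; case: eqP => [->|]; last by rewrite !andbF.
    by rewrite finset.set0U andbT.
  rewrite (_ : all _ _ = true) ?andbT //; apply/allP => x _.
  by rewrite !andbF.
Qed.

(** An edge from an original [x] other than [w] to a copy has a link that is a cone with apex [w].
    Once these edges are gone, the copies are joined to [w] and to [v] only: they form the
    suspension of the link with these two poles. *)
Lemma half_att : pequiv (tcx half_mono half_base) (att hw' (lk v)).
Proof.
pose s := [seq i <- enum {: ground Z * ground Z} | i.1 != w].
apply: (@pequiv_tri_family _ _ _ _ _ _ _ s (fun i => [set i.1]%SET)
  (fun i => [set i.2]%SET) (fun=> false) (fun=> inl w)) => [i _|i j _|i S|F G b].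
- by apply/finset.set0Pn; exists (inl i.1); rewrite !inE.
- by rewrite mem_filter => /andP[jw _]; rewrite !inE eq_sym.
- rewrite mem_filter => /andP[iw _]; rewrite /half_pred !partE !finset.sub1set => + iS jS _.
  case: ifP => [_ /andP[/eqP S0]|_]; first by rewrite S0 inE in iS.
  rewrite /double_pred => /orP[/andP[_ /eqP S0]|ASS]; first by rewrite S0 inE in jS.
  apply/orP; right; apply: A_sub ASS _; apply/fintype.subsetP => y.
  by rewrite !inE; case: eqP.
- have -> : all (fun i => ~~ [&& [set i.1]%SET \subset F,
      [set i.2]%SET \subset G & false ==> b]) s
      = (F \subset [set w]%SET) || (G == finset.set0).
    apply/allP/orP => [FG|].
      case: (eqVneq G finset.set0) => [|/finset.set0Pn[y yG]]; [by right|left].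
      apply/fintype.subsetP => x xF; rewrite inE; apply: contraT => xw.
      have := FG (x, y); rewrite mem_filter mem_enum xw => /(_ isT).
      by rewrite /= !finset.sub1set xF yG.
    move=> FG i; rewrite mem_filter => /andP[iw _]; rewrite !finset.sub1set andbT.
    apply/negP => /andP[iF iG]; case: FG => [/fintype.subsetP/(_ _ iF)|/eqP G0].
      by rewrite inE (negbTE iw).
    by rewrite G0 inE in iG.
  rewrite /att_pred /half_pred /double_pred -/(A G) -/(B F).
  case: b => /=.
    rewrite andbCA subset1_notin andbC; case: (eqVneq F) => [->|] //.
    by rewrite finset.sub0set /= !andbT.
  case: eqVneq => [->|] /=.
    rewrite orbT !andbT finset.setU0.
    by apply/idP/orP => [|[//|/lk_minus_del//]]; left.
  rewrite andbF andbT orbF andbC /=; case: (boolP (F \subset _)) => Fw; last by rewrite !andbF.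
  move: Fw; rewrite -finset.setD_eq0 => /eqP ->.
  by rewrite finset.set0U !andbT.
Qed.

Lemma cone_attach : pequiv (PCx hw) (att hw' (lk v)).
Proof.
apply: pe_trans cone_single _; apply: pe_trans (pe_sym double_single) _.
exact: pe_trans double_half half_att.
Qed.

End ConeAttach.

Section SingleParts.
Variables V U : finType.

Lemma lpart1x (a : U) : lpart (V := V) [set inr (Some a)]%SET = finset.set0.
Proof. by apply/setP => x; rewrite !inE. Qed.
Lemma xpart1x (a : U) : xpart (V := V) [set inr (Some a)]%SET = [set a]%SET.
Proof. by apply/setP => x; rewrite !inE. Qed.
Lemma qpart1x (a : U) : qpart (V := V) [set inr (Some a)]%SET = false.
Proof. by rewrite /qpart inE. Qed.

Lemma mem_lpart (S : {set V + option U}) a : (a \in lpart S) = (inl a \in S).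
Proof. by rewrite inE. Qed.
Lemma mem_xpart (S : {set V + option U}) a : (a \in xpart S) = (inr (Some a) \in S).
Proof. by rewrite inE. Qed.

End SingleParts.

Definition part1E := (lpart1x, xpart1x, qpart1x).

Lemma two_pointsE (F : {set bool}) :
  (F \in faces two_points) = ~~ ((true \in F) && (false \in F)).
Proof.
rewrite inE; apply/idP/idP => [F1|].
  apply/negP => /andP[tF fF]; have : [set true; false]%SET \subset F.
    by rewrite finset.subUset !finset.sub1set tF.
  by move=> /subset_leq_card; rewrite cards2 => /leq_trans/(_ F1).
move=> tf; rewrite leqNgt; apply: contra tf => F2.
have -> : F = [set: bool]%SET; last by rewrite !finset.in_setT.
by apply/eqP; rewrite finset.eqEcard finset.subsetT cardsT card_bool.
Qed.

Lemma mem_susp X (S : {set ground (susp X)}) :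
  (S \in faces (susp X)) = ((inl @^-1: S)%SET \in faces X) &&
    ~~ ((inr true \in S) && (inr false \in S)).
Proof. by rewrite inE two_pointsE !inE. Qed.

Lemma mem_att L p (hp : [set p]%SET \in faces L) X S :
  (S \in faces (cx (att hp X))) = att_pred p (lpart S) (xpart S) (qpart S).
Proof. by rewrite inE. Qed.

(** * Flattening nested attachments *)

Section AttachAttach.
Variables (P Q : pcx) (X : scomplex).
Let b := base Q.
Let Z := cx (Att P (cx (Att Q X))).
Let p : ground Z := inl (base P).
Let w : ground Z := inr (Some (inl b)).
Let v : ground Z := inr (Some (inr None)).

Lemma mem_Z S : (S \in faces Z) =
  if qpart S || (xpart S != finset.set0) then
    [&& lpart S \subset [set base P]%SET,
        att_pred b (lpart (xpart S)) (xpart (xpart S)) (qpart (xpart S)) &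
        ~~ (qpart S && (base P \in lpart S))]
  else lpart S \in faces (cx P).
Proof. by rewrite mem_att /att_pred mem_att. Qed.

Let vw : v != w. Proof. by []. Qed.

Lemma edge_pw : [set p; w]%SET \in faces Z.
Proof.
rewrite mem_Z !partE !part1E /= !partE /=.
have -> : ([set inl b] != finset.set0 :> {set ground (cx Q) + option (ground X)})%SET.
  by apply/finset.set0Pn; exists (inl b); rewrite inE.
by rewrite finset.setU0 fintype.subxx /= /att_pred /= eqxx andbT; exact: base_face.
Qed.

Lemma inner_link (S : {set ground Z}) : v \notin S -> (v |: S)%SET \in faces Z ->
  [/\ lpart S \subset [set base P]%SET, lpart (xpart S) = finset.set0,
    xpart (xpart S) \in faces X, qpart (xpart S) = false &
    ~~ (qpart S && (base P \in lpart S))].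
Proof.
move=> vS; rewrite mem_Z !partE.
have -> : (inr None |: xpart S != finset.set0)%SET.
  by apply/finset.set0Pn; exists (inr None); rewrite !inE eqxx.
rewrite orbT /att_pred /= => /and3P[lS /and3P[lb xX nb] qS]; split=> //.
  by apply/eqP; rewrite -(subset1_notin _ b) lb.
by rewrite /qpart mem_xpart (negbTE vS).
Qed.

(** Within the inner suspension, [v] is joined exactly to the faces of [X], and the other pole [b],
    which appears as [w], is joined to them too. *)
Lemma inner_link_star (S : {set ground Z}) : v \notin S -> (v |: S)%SET \in faces Z ->
  (w |: S)%SET \in faces Z.
Proof.
move=> vS /(inner_link vS)[lS lb xX qx qS].
rewrite mem_Z !partE; case: ifP => _; last first.
  exact: faces_sub (base_face P) lS.
rewrite lS /= lb finset.setU0 qS andbT /att_pred qx /=; case: ifP => _.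
  by rewrite fintype.subxx xX.
exact: base_face.
Qed.

Let hw : [set w]%SET \in faces Z.
Proof. by apply: faces_sub edge_pw _; rewrite finset.subsetUr. Qed.

Lemma del_edge_pw : [set p; w]%SET \in faces (del v).
Proof. by rewrite inE edge_pw !inE. Qed.

Let hw' : [set w]%SET \in faces (del v).
Proof. by apply: faces_sub del_edge_pw _; rewrite finset.subsetUr. Qed.

Let hp' : [set p]%SET \in faces (del v).
Proof. by apply: faces_sub del_edge_pw _; rewrite finset.subsetUl. Qed.

Definition core_pred (S : {set ground Z}) :=
  [&& v \notin S, S \in faces Z & xpart (xpart S) == finset.set0].

Lemma core_down : down_closed core_pred.
Proof.
move=> S T /and3P[vS SZ S0] TS; rewrite /core_pred (faces_sub SZ TS) /=.
have [_ xTS _] := part_sub TS; have [_ xxTS _] := part_sub xTS.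
move: xxTS; rewrite (eqP S0) finset.subset0 => ->; rewrite andbT.
by apply: contra vS; exact: (fintype.subsetP TS).
Qed.

Lemma core_base : [set p]%SET \in faces (dcx core_down).
Proof.
rewrite inE /core_pred !partE eqxx andbT inE /=.
by apply: faces_sub edge_pw _; rewrite finset.subsetUl.
Qed.

(** After the deletion of [v], a vertex of [X] has no neighbour in [Att Q X] besides those in [X]
    and the base point; hence [w] dominates it. *)
Lemma del_core : pequiv (PCx hp') (PCx core_base).
Proof.
apply: (@pequiv_family_pred _ _ _ _ _ _ (enum (ground X))
  (fun x => [set inr (Some (inr (Some x)))]%SET) (fun=> w)) => [x _|x y _ _|x S _|S].
- by apply/finset.set0Pn; exists (inr (Some (inr (Some x)))); rewrite inE.
- by rewrite !inE.
- move=> /andP[vS SZ]; rewrite finset.sub1set => xS.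
  rewrite in_setU1 negb_or vw vS /=.
  have vx : qpart (xpart S) = false by rewrite /qpart mem_xpart (negbTE vS).
  have xx : xpart (xpart S) != finset.set0.
    by apply/finset.set0Pn; exists x; rewrite !mem_xpart.
  have x0 : xpart S != finset.set0.
    by apply/finset.set0Pn; exists (inr (Some x)); rewrite mem_xpart.
  move: SZ; rewrite !mem_Z !partE x0 orbT /att_pred vx xx /=.
  move=> /and3P[-> /and3P[lb xX _] ->]; case: ifP => [_|/norP[_]].
    by rewrite finset.subUset fintype.subxx lb xX.
  by move=> /negP[]; apply/finset.set0Pn; exists (inl b); rewrite !inE eqxx.
- rewrite /core_pred -andbA; congr (_ && _); congr (_ && _).
  rewrite -all_notinP; apply: eq_all => x.
  by rewrite finset.sub1set !mem_xpart.
Qed.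

Lemma att_core : pequiv (Att P (cx Q)) (PCx core_base).
Proof.
pose f : ground (cx (Att P (cx Q))) -> ground Z := tmap id inl.
have fi : injective f by apply: tmap_inj => // x y [].
have l_inl (A : {set ground (cx Q)}) : lpart (inl @: A)%SET = A :> {set _}.
  apply/setP => x; rewrite mem_lpart; apply/imsetP/idP => [[y yA [->]]//|xA].
  by exists x.
have x_inl (A : {set ground (cx Q)}) :
    xpart (U := ground X) (inl @: A)%SET = finset.set0.
  by apply/setP => x; rewrite mem_xpart inE; apply/imsetP => -[].
have q_inl (A : {set ground (cx Q)}) :
    qpart (U := ground X) (inl @: A)%SET = false.
  by apply/imsetP => -[].
apply: (@pe_iso (Att P (cx Q)) (PCx core_base) f) => // [S|T].
- rewrite mem_att inE /core_pred mem_Z lpart_tmap xpart_tmap qpart_tmap.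
  rewrite imset_id l_inl x_inl q_inl eqxx andbT imset_eq0 => SPQ.
  apply/andP; split.
    by apply/imsetP => -[[a|[a|]]].
  by move: SPQ; rewrite /att_pred /= eqxx.
- rewrite inE => /and3P[vT]; rewrite mem_Z => TZ /eqP x0.
  have vx : qpart (xpart T) = false by rewrite /qpart mem_xpart (negbTE vT).
  have xT : xpart T = (inl @: lpart (xpart T))%SET.
    by apply: part_inj; rewrite ?l_inl ?x_inl ?q_inl.
  exists (tset (lpart T) (lpart (xpart T)) (qpart T)).
    rewrite mem_att !tsetE /att_pred; move: TZ; rewrite /att_pred x0 vx eqxx /=.
    by rewrite {1}xT imset_eq0.
  apply: (@part_inj _ _ T (f @: _)%SET).
  + by rewrite lpart_tmap imset_id tsetE.
  + by rewrite xpart_tmap tsetE.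
  + by rewrite qpart_tmap tsetE.
Qed.

Definition susp_lk (z : ground (susp X)) : ground Z :=
  match z with
  | inl x => inr (Some (inr (Some x)))
  | inr true => p
  | inr false => inr None
  end.

(** The faces of [X] are joined to [v] in the inner suspension, and the two poles of the outer one,
    [p] and its free pole, are joined to all of these: they become the poles of a suspension of
    [X]. *)
Lemma susp_lk_embeds : @embeds (susp X) (lk v) susp_lk.
Proof.
have hi : injective susp_lk by move=> [x|[]] [y|[]] //= [->].
have hl (S : {set ground (susp X)}) : lpart (susp_lk @: S)%SET =
    (if inr true \in S then [set base P] else finset.set0)%SET.
  apply/setP => x; rewrite mem_lpart; apply/imsetP/idP => [[[y|[]]] // yS [->]|].
    by rewrite yS inE.
  by case: ifP => [tS|]; rewrite inE // => /eqP ->; exists (inr true).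
have hx (S : {set ground (susp X)}) : xpart (susp_lk @: S)%SET =
    [set z | if z is inr (Some x) then inl x \in S else false]%SET.
  apply/setP => x; rewrite mem_xpart inE; apply/imsetP/idP => [[[y|[]]] // yS [->]//|].
  by case: x => // -[] // x xS; exists (inl x).
have hq (S : {set ground (susp X)}) : qpart (susp_lk @: S)%SET = (inr false \in S).
  by apply/imsetP/idP => [[[y|[]]] //|fS]; exists (inr false).
have hlx (S : {set ground (susp X)}) : lpart (xpart (susp_lk @: S)%SET) = finset.set0.
  by apply/setP => x; rewrite hx !inE.
have hxx (S : {set ground (susp X)}) : xpart (xpart (susp_lk @: S)%SET) = (inl @^-1: S)%SET.
  by apply/setP => x; rewrite hx !inE.
have vS (S : {set ground (susp X)}) : v \notin (susp_lk @: S)%SET by apply/imsetP => -[[x|[]]].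
split=> // [S|T].
- rewrite mem_susp => /andP[xX tf].
  rewrite mem_lk vS mem_Z !partE /= hlx hxx hl hq.
  have -> : (inr None |: xpart (susp_lk @: S) != finset.set0)%SET.
    by apply/finset.set0Pn; exists (inr None); rewrite !inE eqxx.
  rewrite orbT /att_pred /= finset.sub0set xX inE /=.
  move: tf; case: ifP => _ /=; last by rewrite finset.sub0set inE andbF.
  by rewrite fintype.subxx inE eqxx andbT.
- rewrite mem_lk => /andP[vT /(inner_link vT)[lT lx xX qx qT]].
  pose S : {set ground (susp X)} := [set z | susp_lk z \in T]%SET.
  have TS : T = (susp_lk @: S)%SET.
    apply/setP => z; apply/idP/imsetP => [zT|[y]]; last by rewrite inE => yT ->.
    case: z zT => [a|[[a|[x|]]|]] zT.
    + have := fintype.subsetP lT a; rewrite mem_lpart zT => /(_ isT).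
      by rewrite inE => /eqP ap; exists (inr true); rewrite ?inE /= /p -?ap.
    + have := finset.in_set0 a; rewrite -lx mem_lpart mem_xpart.
      by rewrite zT.
    + by exists (inl x); rewrite ?inE.
    + by rewrite [_ \in _](negbTE vT) in zT.
    + by exists (inr false); rewrite ?inE.
  exists S => //; rewrite mem_susp; apply/andP; split.
    by move: xX; rewrite (_ : xpart _ = (inl @^-1: S)%SET) //; apply/setP => x; rewrite !inE.
  by move: qT; rewrite /qpart mem_lpart !inE /= andbC.
Qed.

(** The combinatorial form of Sigma(Q v Sigma X) = Sigma Q v Sigma^2 X. [cone_attach] is applied to
    the free pole [v] of the inner suspension. It glues at [w], so the base point is moved there
    along the edge from [p], and the attachment is then slid back to [p]. *)
Lemma Att_Att : pequiv (Att P (cx (Att Q X))) (Att (Att P (cx Q)) (susp X)).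
Proof.
apply: pe_trans (pe_base (base_face (Att P (cx (Att Q X)))) hw edge_pw) _.
apply: pe_trans (cone_attach vw inner_link_star hw hw') _.
apply: (@pe_trans _ (Att (PCx hp') (lk v))).
  by apply: att_slide; rewrite finset.setUC; exact: del_edge_pw.
apply: (@pe_trans _ (Att (PCx hp') (susp X))).
  by apply: pe_sym; apply: Att_embeds susp_lk_embeds.
by apply: Att_congr_l; apply: pe_trans del_core (pe_sym att_core).
Qed.

End AttachAttach.

(** * Iterated attachments to a point *)

Lemma unit_simplex_base : [set tt]%SET \in faces (simplex unit).
Proof. by rewrite inE. Qed.

Definition one_point : pcx := PCx unit_simplex_base.

Lemma cone_point L p (hp : [set p]%SET \in faces L) :
  (forall S, S \in faces L -> (p |: S)%SET \in faces L) ->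
  pequiv (PCx hp) one_point.
Proof.
case: L p hp => V A hA /= p hp pL.
pose P (S : {set V}) := S \subset [set p]%SET.
have dP : down_closed P by move=> S T /[swap]; exact: fintype.subset_trans.
have pP : [set p]%SET \in faces (dcx dP) by rewrite inE /P.
apply: (@pe_trans _ (PCx pP)).
  apply: (@pequiv_family _ _ _ _ _ _ [seq x <- enum V | x != p] (fun x => [set x]%SET)
    (fun=> p)) => [x _|x y _|x S _ SA _|S].
  - by apply/finset.set0Pn; exists x; rewrite inE.
  - by rewrite mem_filter => /andP[yp _]; rewrite !inE eq_sym.
  - exact: pL.
  - rewrite inE /P; apply/idP/andP => [Sp|[_ /allP Sp]].
      split; first exact: (hA _ _ hp).
      apply/allP => x; rewrite mem_filter finset.sub1set => /andP[xp _].
      by apply: contra xp => /(fintype.subsetP Sp); rewrite inE.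
    apply/fintype.subsetP => x xS; rewrite inE; apply: contraT => xp.
    by have := Sp x; rewrite mem_filter xp mem_enum finset.sub1set xS => /(_ isT).
apply: pe_sym; apply: (@pe_iso one_point (PCx pP) (fun=> p)) => //.
- by move=> [] [].
- move=> S _; rewrite inE /P; apply/fintype.subsetP => x /imsetP[y _ ->].
  by rewrite inE.
- move=> T; rewrite inE /P finset.subset1 => /orP[]/eqP ->.
    by exists [set tt]%SET; rewrite ?imset_set1 ?inE.
  by exists finset.set0; rewrite ?imset0 ?inE.
Qed.

(** The suspension of a point is a path of two edges hanging from the base point. Its free end is
    removed first, giving [R1], then its middle vertex, giving [R2]. *)
Lemma Att_one_point P : pequiv (Att P (cx one_point)) P.
Proof.
pose R1 (F : {set ground (cx P)}) (G : {set unit}) q :=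
  ~~ q && att_pred (X := cx one_point) (base P) F G q.
pose R2 (F : {set ground (cx P)}) (G : {set unit}) q :=
  [&& ~~ q, G == finset.set0 & F \in faces (cx P)].
have m1 : monotone3 R1.
  move=> F F' G G' q q' /andP[qN FG] FF' GG' qq'; apply/andP; split.
    by apply: contra qN.
  exact: (att_mono (base_face P)) FG FF' GG' qq'.
have m2 : monotone3 R2.
  move=> F F' G G' q q' /and3P[qN /eqP -> FP] FF' + qq'; rewrite finset.subset0 => G0.
  by apply/and3P; split=> //; [exact: contra qN|exact: faces_sub FP FF'].
have b1 : R1 [set base P]%SET finset.set0 false by rewrite /R1 (att_base (base_face P)).
have b2 : R2 [set base P]%SET finset.set0 false.
  by rewrite /R2 eqxx (base_face P).
have G0 (G : {set unit}) : (tt \notin G) = (G == finset.set0).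
  apply/idP/eqP => [tG|->]; last by rewrite inE.
  by apply/setP => -[]; rewrite (negbTE tG) inE.
apply: (@pe_trans _ (tcx m1 b1)).
  apply: (@pequiv_tri_family _ _ _ _ _ _ unit [:: tt] (fun=> finset.set0)
    (fun=> finset.set0) (fun=> true) (fun=> inr (Some tt))) => [i _|i j _ _|i S _|F G q].
  - by apply/finset.set0Pn; exists (inr None); rewrite inE.
  - by rewrite !inE.
  - rewrite !partE /att_pred => H _ _ /= qS; move: H; rewrite qS /= => /and3P[-> _ ->].
    by rewrite finset.in_setT.
  - by rewrite /R1 /= !finset.sub0set /= andbT andbC.
apply: (@pe_trans _ (tcx m2 b2)).
  apply: (@pequiv_tri_family _ _ _ _ _ _ unit [:: tt] (fun=> finset.set0)
    (fun=> [set tt]%SET) (fun=> false) (fun=> inl (base P))) => [i _|i j _ _|i S _|F G q].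
  - by apply/finset.set0Pn; exists (inr (Some tt)); rewrite !inE.
  - by rewrite !inE.
  - rewrite /R1 !partE /att_pred finset.sub1set => /andP[/negbTE -> +] _ tS _ /=.
    have -> : xpart S != finset.set0 by rewrite -G0 tS.
    move=> /andP[Sp _]; rewrite finset.subUset Sp fintype.subxx /= inE.
    by [].
  - rewrite /R1 /R2 /= finset.sub0set finset.sub1set !andbT G0 /att_pred.
    case: q => //=; case: eqVneq => //= _; rewrite ?andbT ?andbF //.
apply: pe_sym; apply: (@pe_iso P (tcx m2 b2) inl) => // [x y []//|S SP|T].
- have lS : lpart (U := unit) (inl @: S)%SET = S.
    apply/setP => x; rewrite mem_lpart; apply/imsetP/idP => [[y yS [->]]//|xS].
    by exists x.
  rewrite inE /tri /R2 lS SP andbT; apply/andP; split.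
    by apply/imsetP => -[].
  by rewrite -G0 mem_xpart; apply/imsetP => -[].
- rewrite inE /tri /R2 => /and3P[qT /eqP xT TP]; exists (lpart T) => //.
  apply/setP => -[x|[x|]]; apply/idP/imsetP => [xx|[y]] //.
  + by exists x; rewrite ?inE.
  + by rewrite inE => ? [->].
  + by move/setP/(_ x) : xT; rewrite mem_xpart xx inE.
  + by rewrite /qpart xx in qT.
Qed.

Definition fold_att (P : pcx) (s : seq scomplex) : pcx :=
  foldr (fun X Q => Att Q X) P s.

Lemma fold_att_cat P s1 s2 : fold_att P (s1 ++ s2) = fold_att (fold_att P s2) s1.
Proof. exact: foldr_cat. Qed.

Lemma fold_att_congr P Q s : pequiv P Q -> pequiv (fold_att P s) (fold_att Q s).
Proof. by move=> PQ; elim: s => //= X s; exact: Att_congr_l. Qed.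

(** Suspension distributes over a bouquet: [Att_Att] peels off the outermost attachment at each
    step, and the remaining point is absorbed. *)
Lemma Att_fold P s :
  pequiv (Att P (cx (fold_att one_point s))) (fold_att P [seq susp X | X <- s]).
Proof.
elim: s => [|X s IH] /=; first exact: Att_one_point.
by apply: pe_trans (Att_Att P _ X) _; exact: Att_congr_l.
Qed.

Definition susp_att (X : scomplex) (z : ground (susp X)) : ground (cx (Att one_point X)) :=
  match z with
  | inl x => inr (Some x) | inr true => inl tt | inr false => inr None end.

(** The hypothesis excludes the void complex, whose suspension is void although an attachment always
    contains its base point. *)
Lemma susp_att_embeds X : finset.set0 \in faces X -> embeds (@susp_att X).
Proof.
move=> X0.
have hi : injective (@susp_att X) by move=> [x|[]] [y|[]] //= [->].
have mem_h (S : {set ground (susp X)}) y : (susp_att y \in (@susp_att X) @: S)%SET = (y \in S).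
  exact: mem_imset.
have hq (S : {set ground (susp X)}) :
    qpart ((@susp_att X) @: S)%SET = (inr false \in S) := mem_h S (inr false).
have hl (S : {set ground (susp X)}) : (tt \in lpart ((@susp_att X) @: S)%SET) = (inr true \in S).
  by rewrite mem_lpart (mem_h S (inr true)).
have hx (S : {set ground (susp X)}) : xpart ((@susp_att X) @: S)%SET = (inl @^-1: S)%SET.
  by apply/setP => x; rewrite mem_xpart (mem_h S (inl x)) inE.
have sub_tt (F : {set unit}) : F \subset [set tt]%SET.
  by apply/fintype.subsetP => -[]; rewrite inE.
have E (S : {set ground (susp X)}) :
    ((@susp_att X @: S)%SET \in faces (cx (Att one_point X))) =
    (S \in faces (susp X)).
  rewrite mem_att mem_susp /att_pred hq hl hx sub_tt /= (andbC (inr true \in S)).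
  case: ifP => // /norP[/negbTE ->]; rewrite negbK => /eqP ->.
  by rewrite X0 finset.in_setT.
split=> // [S|T TA]; first by rewrite E.
exists (@susp_att X @^-1: T)%SET; last first.
  apply/setP => z; apply/idP/imsetP => [zT|[y]]; last by rewrite inE => ? ->.
  by case: z zT => [[]|[x|]] zT; [exists (inr true)|exists (inl x)|exists (inr false)];
    rewrite ?inE.
rewrite -E; rewrite (_ : (_ @: _)%SET = T) //.
apply/setP => z; apply/imsetP/idP => [[y]|zT]; first by rewrite inE => ? ->.
by case: z zT => [[]|[x|]] zT; [exists (inr true)|exists (inl x)|exists (inr false)];
  rewrite ?inE.
Qed.

(** * Bouquets and topological wedges *)

(** The first alternative of the last clause serves the empty family, where no piece is available to
    contain the base point. *)
Definition bouquet (W : pcx) (I : Type) (Y : I -> scomplex)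
    (b : forall i, ground (Y i)) (f : forall i, ground (Y i) -> ground (cx W)) :=
  [/\ forall i, injective (f i),
    forall i, f i (b i) = base W,
    forall i j x y, i <> j -> f i x = f j y -> f i x = base W,
    forall i T, T \in faces (Y i) -> (f i @: T)%SET \in faces (cx W) &
    forall S, S \in faces (cx W) -> S \subset [set base W]%SET \/
      exists i, exists2 T, T \in faces (Y i) & S = (f i @: T)%SET].

Section FoldBouquet.
Variable X0 : scomplex.

Definition north (X : scomplex) : ground (susp X) := inr true.

Definition into_att (P : pcx) (X : scomplex) (z : ground (susp X)) :
    ground (cx (Att P X)) :=
  match z with
  | inl x => inr (Some x) | inr true => inl (base P) | inr false => inr None end.

(** List and index are matched together so that the type involving [nth] reduces in every branch.
    The value for the empty list is a filler, no index being in range. *)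
Fixpoint into_fold (s : seq scomplex) (i : nat) :
    ground (susp (nth X0 s i)) -> ground (cx (fold_att one_point s)) :=
  match s, i return
      ground (susp (nth X0 s i)) -> ground (cx (fold_att one_point s)) with
  | [::], _ => fun _ => tt
  | X :: s', 0%N => @into_att (fold_att one_point s') X
  | X :: s', i'.+1 => fun z => inl (@into_fold s' i' z)
  end.

Lemma into_att_inj P X : injective (@into_att P X).
Proof. by move=> [x|[]] [y|[]] //= [->]. Qed.

Lemma into_att_faces P X T : finset.set0 \in faces X ->
  T \in faces (susp X) -> (@into_att P X @: T)%SET \in faces (cx (Att P X)).
Proof.
move=> X0' ; rewrite mem_susp mem_att => /andP[TX tf].
have hq : qpart (@into_att P X @: T)%SET = (inr false \in T).
  exact: (mem_imset T (inr false) (@into_att_inj P X)).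
have hl : lpart (@into_att P X @: T)%SET =
    (if inr true \in T then [set base P] else finset.set0)%SET.
  apply/setP => x; rewrite mem_lpart; apply/imsetP/idP => [[[y|[]]] // yS [->]|].
    by rewrite yS inE.
  by case: ifP => [tS|]; rewrite inE // => /eqP ->; exists (inr true).
have hx : xpart (@into_att P X @: T)%SET = (inl @^-1: T)%SET.
  apply/setP => x; rewrite mem_xpart inE.
  exact: (mem_imset T (inl x) (@into_att_inj P X)).
rewrite /att_pred hq hl hx TX; case: ifP => _.
  apply/andP; split; first by case: ifP; rewrite ?finset.sub0set.
  by move: tf; case: ifP => _; rewrite inE ?eqxx ?andbT ?andbF.
case: ifP => _; first exact: base_face.
by apply: faces_sub (base_face P) _; exact: finset.sub0set.
Qed.

Lemma into_att_onto P X S : S \in faces (cx (Att P X)) ->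
  qpart S || (xpart S != finset.set0) ->
  exists2 T, T \in faces (susp X) & S = (@into_att P X @: T)%SET.
Proof.
rewrite mem_att /att_pred => + qx; rewrite qx => /and3P[lS xS qS].
exists (@into_att P X @^-1: S)%SET.
  rewrite mem_susp !inE; apply/andP; split; last first.
    by move: qS; rewrite /qpart mem_lpart andbC.
  by move: xS; rewrite (_ : xpart S = (inl @^-1: (@into_att P X @^-1: S))%SET) //;
    apply/setP => x; rewrite !inE.
apply/setP => z; apply/idP/imsetP => [zS|[y]]; last by rewrite inE => ? ->.
case: z zS => [x|[x|]] zS.
- have := fintype.subsetP lS x; rewrite mem_lpart zS => /(_ isT).
  by rewrite inE => /eqP xb; exists (inr true); rewrite ?inE /= -?xb.
- by exists (inl x); rewrite ?inE.
- by exists (inr false); rewrite ?inE.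
Qed.

Lemma att_inl P X (A : {set ground (cx P)}) : A \in faces (cx P) ->
  (inl @: A)%SET \in faces (cx (Att P X)).
Proof.
move=> AP; rewrite mem_att /att_pred.
have -> : lpart (U := ground X) (inl @: A)%SET = A.
  by apply/setP => x; rewrite mem_lpart mem_imset // => ? ? [].
have -> : xpart (U := ground X) (inl @: A)%SET = finset.set0.
  by apply/setP => x; rewrite mem_xpart inE; apply/imsetP => -[].
have -> : qpart (U := ground X) (inl @: A)%SET = false.
  by apply/imsetP => -[].
by rewrite eqxx.
Qed.

Lemma fold_bouquet (s : seq scomplex) :
  (forall i, (i < size s)%N -> finset.set0 \in faces (nth X0 s i)) ->
  @bouquet (fold_att one_point s) {i | (i < size s)%N}
    (fun i => susp (nth X0 s (val i))) (fun i => north _)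
    (fun i => @into_fold s (val i)).
Proof.
elim: s => [|X s IH] sX0.
  split; try by case.
  by move=> S _; left; apply/fintype.subsetP => -[]; rewrite inE.
have [inj fb dis fT Tf] := IH (fun i => sX0 i.+1).
have X0' : finset.set0 \in faces X := sX0 0%N isT.
split.
- case=> -[|i] /= is_; first exact: into_att_inj.
  by move=> x y [] /(inj (exist _ i is_)).
- by case=> -[|i] /= is_ //; congr inl; exact: (fb (exist _ i is_)).
- case=> -[|i] is_ [[|j] js] x y ij /=.
  + by case: ij; apply: val_inj.
  + case: x => [x|[]] //= [] e; congr inl.
  + case: y => [y|[]] //= [] ->; by [].
  + case=> e; congr inl; apply: (dis (exist _ i is_) (exist _ j js)) e.
    by move=> [] eij; apply: ij; apply: val_inj => /=; rewrite eij.
- case=> -[|i] is_ T TY; first exact: into_att_faces.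
  have := att_inl X (fT (exist _ i is_) T TY); rewrite -imset_comp; exact.
- move=> S SA; case: (boolP (qpart S || (xpart S != finset.set0))) => qx.
    have [T TX ->] := into_att_onto SA qx; right.
    by exists (exist (fun i => i < size (X :: s))%N 0%N (ltn0Sn _)), T.
  move: SA; rewrite mem_att /att_pred (negbTE qx) => lS.
  move: qx => /norP[qS]; rewrite negbK => /eqP xS.
  have SE : S = (inl @: lpart S)%SET.
    apply/setP => -[x|[x|]].
    + by rewrite mem_imset ?mem_lpart // => ? ? [].
    + by rewrite -mem_xpart xS inE; apply/esym/imsetP => -[].
    + by rewrite [LHS](negbTE qS); apply/esym/imsetP => -[].
  have [lb|[[i is_] [T TY lT]]] := Tf _ lS; [left|right].
    by rewrite SE /= -imset_set1 imsetS.
  exists (exist (fun i => i < size (X :: s))%N i.+1 is_), T => //=.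
  by rewrite SE lT -imset_comp.
Qed.

End FoldBouquet.

Section BouquetWedge.
Variables (R : realType) (W : pcx) (I : choiceType) (Y : I -> scomplex).
Variables (b : forall i, ground (Y i)) (f : forall i, ground (Y i) -> ground (cx W)).
Variable pb : forall i, realization R (Y i).
Hypothesis Ifin : finite_set [set: I].
Hypothesis fW : bouquet b f.
Hypothesis pbE : forall i, weight (pb i) = vertex_fun R (b i).

Let f_inj i : injective (f (i := i)). Proof. by have [+ _ _ _ _] := fW; apply. Qed.
Let f_base i : f (b i) = base W. Proof. by have [_ + _ _ _] := fW; apply. Qed.
Let f_disj i j x y : i <> j -> f (i := i) x = f (i := j) y -> f x = base W.
Proof. by have [_ _ + _ _] := fW; apply. Qed.
Let f_faces i T : T \in faces (Y i) -> (f (i := i) @: T)%SET \in faces (cx W).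
Proof. by have [_ _ _ + _] := fW; apply. Qed.
Let f_cover (S : {set ground (cx W)}) : S \in faces (cx W) ->
  S \subset [set base W]%SET \/
  exists i, exists2 T, T \in faces (Y i) & S = (f (i := i) @: T)%SET.
Proof. by have [_ _ _ _ +] := fW; apply. Qed.

(** The default [b i] makes this the map that sends all the other pieces to the base point. *)
Definition retract i (z : ground (cx W)) : ground (Y i) :=
  odflt (b i) [pick y | f (i := i) y == z].

Lemma retractK i : cancel (f (i := i)) (@retract i).
Proof.
move=> y; rewrite /retract; case: pickP => [u /eqP /f_inj //|/(_ y)].
by rewrite eqxx.
Qed.

Lemma retract_base i : retract i (base W) = b i.
Proof. by rewrite -(f_base i) retractK. Qed.

Lemma retract_other i j y : i <> j -> retract i (f (i := j) y) = b i.
Proof.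
move=> ij; rewrite /retract; case: pickP => // x /eqP e /=.
by apply: f_inj; rewrite (f_disj ij e) f_base.
Qed.

Lemma weight_vertex (L : scomplex) (x : realization R L) v :
  rsupp (weight x) \subset [set v]%SET -> weight x = vertex_fun R v.
Proof.
move=> xv; have sx : \sum_u weight x u = weight x v.
  rewrite (bigD1 v) //= big1 ?addr0 // => u uv; apply: weight0.
  by apply: contra uv => /(fintype.subsetP xv); rewrite inE.
apply/funext => u; rewrite /vertex_fun; case: eqVneq => [->|uv].
  by rewrite -sx weight_sum.
by apply: weight0; apply: contra uv => /(fintype.subsetP xv); rewrite inE.
Qed.

Lemma rsupp_vertex (V : finType) (v : V) : rsupp (vertex_fun R v) = [set v]%SET.
Proof.
by apply/setP => u; rewrite !inE /vertex_fun pnatr_eq0 eqb0 negbK.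
Qed.

Lemma base_vertex i : [set b i]%SET \in faces (Y i).
Proof. by have := weight_face (pb i); rewrite pbE rsupp_vertex. Qed.

Lemma retract_faces i (S : {set ground (cx W)}) :
  S \in faces (cx W) -> (retract i @: S)%SET \in faces (Y i).
Proof.
have sub (A : {set ground (Y i)}) : A \subset [set b i]%SET -> A \in faces (Y i).
  by apply: faces_sub; exact: base_vertex.
case/f_cover => [Sb|[j [T TY ->]]].
  apply: sub; apply/fintype.subsetP => x /imsetP[z /(fintype.subsetP Sb) + ->].
  by rewrite !inE => /eqP ->; rewrite retract_base.
rewrite -imset_comp; have [ij|ij] := pselect (i = j).
  move: ij T TY => <- T TY.
  rewrite (_ : (_ @: T)%SET = T) // -[RHS]imset_id; apply: eq_imset => x /=.
  exact: retractK.
apply: sub; apply/fintype.subsetP => x /imsetP[z _ ->].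
by rewrite /= retract_other // inE.
Qed.

Definition into i : realization R (Y i) -> realization R (cx W) :=
  push (@f_faces i).

Definition onto i : realization R (cx W) -> realization R (Y i) :=
  push (@retract_faces i).

Definition base_pt : realization R (cx W) :=
  rpoint (vertex_realization R (base_face W)).

Lemma base_ptP (x : realization R (cx W)) :
  rsupp (weight x) \subset [set base W]%SET -> x = base_pt.
Proof. by move=> xb; apply: weight_inj; rewrite (weight_vertex xb). Qed.

Lemma into_base i : into (pb i) = base_pt.
Proof.
apply: base_ptP; rewrite /into weight_rpoint rsupp_pushw pbE rsupp_vertex.
by rewrite imset_set1 f_base.
Qed.

Lemma onto_base i : onto i base_pt = pb i.
Proof.
apply: weight_inj; rewrite pbE; apply: weight_vertex.
rewrite weight_rpoint rsupp_pushw weight_rpoint rsupp_vertex imset_set1.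
by rewrite retract_base.
Qed.

Lemma into_onto i (y : realization R (Y i)) : onto i (into y) = y.
Proof.
apply: weight_inj; rewrite weight_rpoint pushw_comp pushw_id // => x _ /=.
exact: retractK.
Qed.

Definition sector i (x : realization R (cx W)) : Prop :=
  rsupp (weight x) \subset [set f (i := i) y | y : ground (Y i)]%SET.

Lemma into_sector i (y : realization R (Y i)) : sector i (into y).
Proof.
rewrite /sector weight_rpoint rsupp_pushw; apply/fintype.subsetP => z /imsetP[x _ ->].
by apply/imsetP; exists x.
Qed.

Lemma onto_into i x : sector i x -> into (onto i x) = x.
Proof.
move=> xi; apply: weight_inj; rewrite weight_rpoint pushw_comp pushw_id //.
by move=> z /(fintype.subsetP xi)/imsetP[y _ ->] /=; rewrite retractK.
Qed.

Lemma sector2 i j x : i <> j -> sector i x -> sector j x -> x = base_pt.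
Proof.
move=> ij xi xj; apply: base_ptP; apply/fintype.subsetP => z zx.
have /imsetP[y _ zy] := fintype.subsetP xi _ zx.
have /imsetP[u _ zu] := fintype.subsetP xj _ zx.
by rewrite inE zy; apply/eqP; apply: (f_disj ij); rewrite -zy zu.
Qed.

Lemma sector_cover x : (exists i, sector i x) \/ x = base_pt.
Proof.
have [xb|[i [T _ xT]]] := f_cover (weight_face x); first by right; exact: base_ptP.
left; exists i; rewrite /sector xT; apply/fintype.subsetP => z /imsetP[y _ ->].
by apply/imsetP; exists y.
Qed.

Lemma closed_sector i : closed (sector i).
Proof.
have -> : sector i = \bigcap_(v in [set v : ground (cx W) |
    v \notin [set f (i := i) y | y : ground (Y i)]%SET])
    ((fun x => weight x v) @^-1` [set 0]).
  apply/seteqP; split=> [x xi v /= vi|x xi].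
    by apply: weight0; apply: contra vi; exact: (fintype.subsetP xi).
  apply/fintype.subsetP => v; rewrite inE; apply: contraNT => vi.
  by apply/eqP; exact: (xi v).
apply: closed_bigI => v _.
apply: (@continuous_closedP _ _ _).1; first exact: weight_continuous.
exact: closed_eq.
Qed.

Let wed : topologicalType := wedge_sum pb.
Let lift (o : option I) : with_point (fun i => realization R (Y i)) o -> wed :=
  @wedge_lift _ _ (with_point_base pb) o.

Definition to_bouquet (o : option I) :
    with_point (fun i => realization R (Y i)) o -> realization R (cx W) :=
  match o with Some i => @into i | None => fun _ => base_pt end.

Lemma to_bouquet_base o : to_bouquet (with_point_base pb o) = base_pt.
Proof. by case: o => [i|] //=; exact: into_base. Qed.

Definition wedge_bouquet : wed -> realization R (cx W) := wedge_fun to_bouquet.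

Lemma wedge_bouquet_continuous : continuous wedge_bouquet.
Proof.
apply: wedge_fun_continuous => [[i|]|o o'] /=.
- exact: push_continuous.
- exact: cst_continuous.
- by rewrite !to_bouquet_base.
Qed.

(** The choice of the sector is immaterial because two sectors meet in the base point only. The
    second branch arises for an empty family alone, as the base point otherwise lies in every
    sector; it uses the one-point summand of [wedge_sum]. *)
Definition bouquet_wedge (x : realization R (cx W)) : wed :=
  match pselect (exists i, sector i x) with
  | left e => lift (o := Some (projT1 (cid e))) (onto _ x)
  | right _ => lift (o := None) tt
  end.

Lemma lift_base i : lift (o := Some i) (pb i) = lift (o := None) tt.
Proof. exact: (@wedge_liftE _ _ (with_point_base pb) None tt (Some i) (pb i)). Qed.

Lemma bouquet_wedge_base : bouquet_wedge base_pt = lift (o := None) tt.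
Proof.
by rewrite /bouquet_wedge; case: pselect => // e; rewrite onto_base lift_base.
Qed.

Lemma bouquet_wedge_sector i x : sector i x ->
  bouquet_wedge x = lift (o := Some i) (onto i x).
Proof.
move=> xi; rewrite /bouquet_wedge; case: pselect => [e|[]]; last by exists i.
case: (cid e) => j /= xj; have [<-//|ij] := pselect (i = j).
by rewrite (sector2 ij xi xj) !onto_base !lift_base.
Qed.

Lemma bouquet_wedge_continuous : continuous bouquet_wedge.
Proof.
apply/continuous_closedP => C cC.
(* The preimage is a finite union of closed sets, one for each sector, plus possibly the base point,
   which no sector covers when the family is empty. *)
have -> : bouquet_wedge @^-1` C =
    (\bigcup_(i in [set: I]) (sector i `&` (fun x => lift (o := Some i) (onto i x)) @^-1` C))
    `|` [set x | x = base_pt /\ C (lift (o := None) tt)].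
  apply/seteqP; split=> [x xC|x [[i _ [xi xC]]|[-> xC]]] /=.
  - have [[i xi]|xb] := sector_cover x.
      by left; exists i => //; split=> //=; rewrite -(bouquet_wedge_sector xi).
    by right; split=> //; rewrite -bouquet_wedge_base -xb.
  - by rewrite (bouquet_wedge_sector xi).
  - by rewrite bouquet_wedge_base.
apply: closedU.
  apply: closed_bigcup => // i _; apply: closedI; first exact: closed_sector.
  have clo : continuous (fun x => lift (o := Some i) (onto i x)).
    move=> x; apply: (@continuous_comp _ _ _ (onto i) (lift (o := Some i))).
      exact: push_continuous.
    exact: wedge_lift_continuous.
  by apply: (continuous_closedP _).1.
have [bC|bC] := pselect (C (lift (o := None) tt)); last first.
  rewrite [X in closed X](_ : _ = set0); first exact: closed0.
  by apply/seteqP; split=> // x [_ /bC].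
rewrite [X in closed X](_ : _ = \bigcap_(v in [set: ground (cx W)])
    ((fun x => weight x v) @^-1` [set vertex_fun R (base W) v])).
  apply: closed_bigI => v _.
  apply: (@continuous_closedP _ _ _).1; first exact: weight_continuous.
  exact: closed_eq.
apply/seteqP; split=> [x [-> _] v _ //|x xb]; split=> //.
by apply: weight_inj; apply/funext => v; exact: xb.
Qed.

Lemma bouquet_equivalent :
  homotopy_equivalent R (realization R (cx W)) (wedge_sum pb).
Proof.
exists bouquet_wedge, wedge_bouquet; split.
- exact: bouquet_wedge_continuous.
- exact: wedge_bouquet_continuous.
- have -> : wedge_bouquet \o bouquet_wedge = id.
    apply/funext => x /=; have [[i xi]|->] := sector_cover x.
      rewrite (bouquet_wedge_sector xi) /wedge_bouquet /lift wedge_lift_funE.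
        exact: onto_into.
      by move=> o o'; rewrite !to_bouquet_base.
    rewrite bouquet_wedge_base /wedge_bouquet /lift wedge_lift_funE //.
    by move=> o o'; rewrite !to_bouquet_base.
  by apply: homotopic_refl => x; exact: cvg_id.
- have -> : bouquet_wedge \o wedge_bouquet = id.
    apply/funext => z /=; have : [set: wed] z by [].
    rewrite -wedgeTE => -[j _ [y _ <-]]; rewrite /wedge_bouquet wedge_lift_funE.
      case: j y => [i|] y /=; last by rewrite bouquet_wedge_base; case: y.
      by rewrite (bouquet_wedge_sector (into_sector y)) into_onto.
    by move=> o' o''; rewrite !to_bouquet_base.
  by apply: homotopic_refl => x; exact: cvg_id.
Qed.

End BouquetWedge.

(** * Packings of intervals *)

(** Encoded from the right: [i] is the start of the last interval and the others must fit into [0,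
    i), which makes the intervals disjoint and ordered at once. *)
Fixpoint pack (t k n : nat) (A : nat -> bool) : Prop :=
  if k is k'.+1 then exists i : nat,
    [/\ (i + t <= n)%N, forall x, (i <= x < i + t)%N -> ~~ A x & pack t k' i A]
  else True.

Section Pack.
Variable t : nat.

Lemma pack_sub k n n' (A A' : nat -> bool) : (n <= n')%N ->
  (forall x, (x < n)%N -> A' x -> A x) -> pack t k n A -> pack t k n' A'.
Proof.
elim: k n n' => //= k IH n n' nn' AA' [i [it Ai pi]]; exists i; split.
- exact: leq_trans it nn'.
- move=> x xi; have := Ai x xi; apply: contra; apply: AA'.
  by case/andP: xi => _ xi; exact: leq_trans xi it.
- apply: (IH i i) => // x xi; apply: AA'; apply: leq_trans it.
  by rewrite (leq_trans xi) ?leq_addr.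
Qed.

(* The last interval starts at most at n - t <= y and avoids y, hence ends
   before y. *)
Lemma pack_trim k n y (A : nat -> bool) : A y -> (n <= y + t)%N ->
  pack t k n A -> pack t k y A.
Proof.
case: k => //= k Ay ny [i [it Ai pi]]; exists i; split=> //.
rewrite leqNgt; apply/negP => yi; have := Ai y; rewrite Ay yi andbT.
by move=> /(_ _)/negP; apply=> //; lia.
Qed.

Lemma pack_trim_sub k n y (A A' : nat -> bool) : A y -> (n <= y + t)%N ->
  (forall x, A' x -> A x) -> pack t k n A -> pack t k y A'.
Proof. by move=> Ay ny AA' /(pack_trim Ay ny); apply: pack_sub => // x _; exact: AA'. Qed.

Lemma pack_drop k n (A : nat -> bool) : pack t k.+1 n A -> pack t k (n - t) A.
Proof. by move=> [i [it _]]; apply: pack_sub => //; lia. Qed.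

Lemma pack_add k n (A : nat -> bool) :
  (forall x, (n <= x < n + t)%N -> ~~ A x) -> pack t k n A ->
  pack t k.+1 (n + t) A.
Proof. by move=> An pn; exists n. Qed.

Lemma pack_free k n (A : nat -> bool) :
  (k * t <= n)%N -> (forall x, (x < n)%N -> ~~ A x) -> pack t k n A.
Proof.
elim: k n => //= k IH n; rewrite mulSn => kn An; exists (k * t)%N; split.
- lia.
- by move=> x xk; apply: An; lia.
- by apply: IH => // x xk; apply: An; lia.
Qed.

(** Drop the first interval instead of the last: each remaining one has at least t > 0 positions on
    its left, hence misses 0. *)
Lemma pack_first k n (A : nat -> bool) : (0 < t)%N -> pack t k.+1 n A ->
  pack t k n (fun x => (x == 0)%N || A x).
Proof.
move=> t_gt0; elim: k n => // k IH n /= [i [it Ai pi]]; exists i; split=> //.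
  move=> x xi; rewrite negb_or Ai // andbT.
  have [j [jt _ _]] := pi; lia.
exact: IH.
Qed.

End Pack.

Definition occ (N : nat) (F : {set 'I_N}) (x : nat) : bool :=
  [exists y in F, val y == x].

Lemma occP N (F : {set 'I_N}) x :
  reflect (exists2 y, y \in F & val y = x) (occ F x).
Proof.
apply: (iffP existsP) => [[y /andP[yF /eqP]]|[y yF yx]]; first by exists y.
by exists y; rewrite yF yx eqxx.
Qed.

Lemma occ_mem N (F : {set 'I_N}) y : occ F (val y) = (y \in F).
Proof. by apply/occP/idP => [[z zF /val_inj <-]|yF] //; exists y. Qed.

Lemma occU1 N (F : {set 'I_N}) v x :
  occ (v |: F)%SET x = (x == val v) || occ F x.
Proof.
apply/occP/orP => [[y]|[/eqP ->|/occP[y yF yx]]].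
- by rewrite !inE => /orP[/eqP ->|yF] <-; [left|right; rewrite occ_mem].
- by exists v; rewrite // !inE eqxx.
- by exists y; rewrite // !inE yF orbT.
Qed.

Lemma occ0 N x : occ (N := N) finset.set0 x = false.
Proof. by apply/occP => -[y]; rewrite inE. Qed.

Lemma occ1 N (v : 'I_N) x : occ [set v]%SET x = (x == val v).
Proof.
by rewrite -[[set v]%SET]finset.setU0 occU1 occ0 orbF.
Qed.

Lemma occ_imset N M (f : 'I_N -> 'I_M) (F : {set 'I_N}) :
  (forall y, val (f y) = val y) -> occ (f @: F)%SET =1 occ F.
Proof.
move=> fE x; apply/occP/occP => [[_ /imsetP[y yF ->]] <-|[y yF <-]].
  by exists y.
by exists (f y); rewrite ?imset_f.
Qed.

Definition packed (t N : nat) (S : nat -> bool) (k n : nat) (F : {set 'I_N}) : bool :=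
  `[< (forall x, occ F x -> S x) /\ pack t k n (occ F) >].

Lemma packedP t N (S : nat -> bool) k n (F : {set 'I_N}) :
  reflect ((forall x, occ F x -> S x) /\ pack t k n (occ F)) (packed t S k n F).
Proof. exact: asboolP. Qed.

Lemma packed_down t N (S : nat -> bool) k n : down_closed (@packed t N S k n).
Proof.
move=> F G /packedP[FS pF] GF.
have occG x : occ G x -> occ F x.
  by move=> /occP[y /(fintype.subsetP GF) yF yx]; apply/occP; exists y.
apply/packedP; split=> [x /occG /FS //|].
by apply: pack_sub pF => // x _; exact: occG.
Qed.

(* The positions outside S are kept in the ground set, without being vertices,
   so that all the subcomplexes met in the recursion share the ground set 'I_N. *)
Definition packing (t N : nat) (S : nat -> bool) (k n : nat) : scomplex :=
  dcx (@packed_down t N S k n).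

Lemma packingP t N (S : nat -> bool) k n (F : {set 'I_N}) :
  reflect ((forall x, occ F x -> S x) /\ pack t k n (occ F))
          (F \in faces (packing t N S k n)).
Proof. by rewrite inE; exact: packedP. Qed.

Definition pack_complex (t m k : nat) := packing t m xpredT k m.

Lemma packing_embeds t N m k : (m <= N)%N ->
  exists2 f : ground (pack_complex t m k) -> ground (packing t N (fun x => x < m)%N k m),
    embeds f & forall y, val (f y) = val y.
Proof.
move=> mN; exists (widen_ord mN) => //; split.
- by move=> x y /(congr1 val) /= xy; exact: val_inj.
- move=> S /packingP[_ pS]; apply/packingP; split.
    by move=> x; rewrite occ_imset // => /occP[y _ <-]; exact: ltn_ord.
  by apply: pack_sub pS => // x _; rewrite occ_imset.
- move=> T /packingP[Tm pT]; exists (widen_ord mN @^-1: T)%SET.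
    apply/packingP; split=> //; apply: pack_sub pT => // x _.
    by move=> /occP[y]; rewrite inE => yT <-; apply/occP; exists (widen_ord mN y).
  apply/setP => x; apply/idP/imsetP => [xT|[y]]; last by rewrite inE => ? ->.
  have xm : (x < m)%N by apply: Tm; rewrite occ_mem.
  by exists (Ordinal xm); rewrite ?inE; [rewrite (_ : widen_ord _ _ = x)|]; try exact: val_inj.
Qed.

Lemma pack_complex_base t n k : (k * t <= n)%N ->
  [set ord_max]%SET \in faces (pack_complex t n.+1 k).
Proof.
move=> kn; apply/packingP; split=> //.
have p0 : pack t k n (occ [set (ord_max : 'I_n.+1)]%SET).
  by apply: pack_free => // x xn; rewrite occ1 /= neq_ltn xn.
exact: pack_sub p0.
Qed.

Lemma embeds_eq (V : finType) (A B : {set {set V}}) hA hB : A =i B ->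
  @embeds (@SComplex V A hA) (@SComplex V B hB) id.
Proof.
move=> AB; split=> // [S|S] /= SA; first by rewrite imset_id -AB.
by exists S; rewrite ?imset_id ?AB.
Qed.

Definition susp_map X Y (f : ground X -> ground Y) (z : ground (susp X)) :
    ground (susp Y) :=
  match z with inl x => inl (f x) | inr e => inr e end.

Lemma susp_embeds X Y (f : ground X -> ground Y) : embeds f -> embeds (susp_map f).
Proof.
move=> [fi fX fY].
have gi : injective (susp_map f) by move=> [x|e] [y|e'] //= [] => [/fi ->|->].
have gl (S : {set ground (susp X)}) :
    (inl @^-1: (susp_map f @: S))%SET = (f @: (inl @^-1: S))%SET.
  apply/setP => y; rewrite inE; apply/imsetP/imsetP => [[[x|e]] // xS [->]|[x]].
    by exists x; rewrite ?inE.
  by rewrite inE => xS ->; exists (inl x).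
have gr (S : {set ground (susp X)}) e :
    (inr e \in susp_map f @: S)%SET = (inr e \in S).
  exact: (mem_imset S (inr e) gi).
split=> // [S|T].
  by rewrite !mem_susp gl !gr => /andP[/fX -> ->].
rewrite mem_susp => /andP[/fY[F FX TF] tf].
have TE : T = (susp_map f @: (susp_map f @^-1: T))%SET.
  apply/setP => z; apply/idP/imsetP => [zT|[y]]; last by rewrite inE => ? ->.
  case: z zT => [y|e] zT; last by exists (inr e); rewrite ?inE.
  have : y \in (inl @^-1: T)%SET by rewrite inE.
  rewrite TF => /imsetP[x xF yx]; exists (inl x); rewrite ?inE /= -?yx //.
exists (susp_map f @^-1: T)%SET => //; rewrite mem_susp !inE /= tf andbT.
rewrite (_ : (inl @^-1: _)%SET = F) //; apply/setP => x; rewrite !inE /=.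
by rewrite -(mem_imset F x fi) -TF inE.
Qed.

(** * The recursion for packing complexes *)

Section Recursion.
Variables (t m k : nat) (t_gt0 : (0 < t)%N) (km : (k.+1 * t <= m)%N).
(** Here [n] is the last position: the complex under study has m + t + 1 positions. *)
Let n := (m + t)%N.
Let v : 'I_n.+1 := ord_max.
Let w : 'I_n.+1 := Ordinal (leq_addr t m : (m < n.+1)%N).
Let m_gt0 : (0 < m)%N.
Proof. by rewrite (leq_trans _ km) // mulSn ltn_addr. Qed.
Let o : 'I_n.+1 := ord0.

Let top (x : nat) : bool := (x <= m)%N || (x == n).
Let D1 := packing t n.+1 top k.+1 n.+1.

Lemma top_edge : [set v; w]%SET \in faces D1.
Proof.
apply/packingP; split=> [x|].
  rewrite occU1 occ1 /= /top => /orP[/eqP ->|/eqP ->]; first by rewrite eqxx orbT.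
  by rewrite leqnn.
have : pack t k.+1 m (occ [set v; w]%SET).
  apply: pack_free => // x xm; rewrite occU1 occ1 /= negb_or.
  by rewrite !neq_ltn xm (leq_trans xm) // leq_addr.
by apply: pack_sub => //; lia.
Qed.

Let hv : [set v]%SET \in faces D1.
Proof. by apply: faces_sub top_edge _; rewrite finset.subsetUl. Qed.
Let hw : [set w]%SET \in faces D1.
Proof. by apply: faces_sub top_edge _; rewrite finset.subsetUr. Qed.

(** Let a face contain a position x with m < x < n. An interval starting beyond x would have to end
    beyond n, so all the intervals lie below x, and n can be added to the face. *)
Lemma pack_complex_top (hp : [set v]%SET \in faces (pack_complex t n.+1 k.+1)) :
  pequiv (PCx hp) (PCx hv).
Proof.
have outside S : S \in faces (pack_complex t n.+1 k.+1) -> S \notin faces D1 ->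
    exists2 x : 'I_n.+1, x \in S & (m < x < n)%N.
  move=> /packingP[_ pS] SD; apply: contrapT => H; move/negP: SD; apply.
  apply/packingP; split=> // x /occP[y yS <-]; apply: contrapT => /negP.
  rewrite /top negb_or -ltnNge => /andP[my yn]; apply: H; exists y => //.
  by rewrite my /= ltn_neqAle yn -ltnS ltn_ord.
apply: (@pequiv_cone _ _ _ _ _ v).
- apply/fintype.subsetP => S /packingP[_ pS]; exact/packingP.
- move=> S SD /(outside _ SD)[x xS /andP[mx xn]].
  have /packingP[_ pS] := SD; apply/packingP; split=> //.
  have : pack t k.+1 x (occ S).
    by apply: pack_trim pS; rewrite ?occ_mem //; lia.
  apply: pack_sub => [|y yx]; first by rewrite ltnW.
  by rewrite occU1 /= (ltn_eqF (ltn_trans yx xn)).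
- move=> S SD /(outside _ SD)[x xS /andP[mx xn]].
  apply/negP => /packingP[St _]; have := St x; rewrite occ_mem !inE xS andbT.
  rewrite /top leqNgt mx (ltn_eqF xn) /= => H; suff: false by [].
  by apply: H; rewrite -val_eqE /= (ltn_eqF xn).
Qed.

Let vw : v != w.
Proof. by rewrite -val_eqE /= /n -[X in _ != X]addn0 eqn_add2l -lt0n. Qed.

Lemma top_link_star (F : {set 'I_n.+1}) : v \notin F -> (v |: F)%SET \in faces D1 ->
  (w |: F)%SET \in faces D1.
Proof.
move=> vF /packingP[Ft pF]; apply/packingP; split=> [x|].
  rewrite occU1 => /orP[/eqP ->|xF]; first by rewrite /top leqnn.
  by apply: Ft; rewrite occU1 xF orbT.
have pm : pack t k m (occ F).
  have /pack_drop : pack t k.+1 n (occ F).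
    apply: (pack_trim_sub (y := n) _ _ _ pF) => [||x xF]; [|lia|].
      by rewrite occU1 eqxx.
    by rewrite occU1 xF orbT.
  by rewrite addnK.
(* The dropped interval is replaced by the last t positions m + 1, ..., n. They avoid [F], which
   lies in [top] and does not contain [v]. *)
apply: (@pack_add t k m.+1) => [x /andP[mx xn]|]; last first.
  by apply: pack_sub pm => // x xm; rewrite occU1 /= (ltn_eqF xm).
rewrite occU1 /= (gtn_eqF mx) /=; apply/negP => xF.
have := Ft x; rewrite occU1 xF orbT /top leqNgt mx => /(_ isT)/eqP xn'.
by case/occP: xF => y yF yx; move: vF; rewrite (_ : v = y) ?yF //; apply: val_inj;
  rewrite yx xn'.
Qed.

Let E := packing t n.+1 (fun x => x < m.+1)%N k.+1 n.
Let Dm1 := packing t n.+1 (fun x => x < m.+1)%N k m.+1.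

Lemma top_notin (F : {set 'I_n.+1}) :
  (v \notin F) /\ (forall x, occ F x -> top x) <->
  (forall x, occ F x -> (x < m.+1)%N).
Proof.
split=> [[vF Ft] x xF|Fm].
  have /orP[//|/eqP xn] := Ft _ xF.
  by case/occP: xF => y yF yx; move: vF; rewrite (_ : v = y) ?yF //; apply: val_inj;
    rewrite yx xn.
split=> [|x /Fm xm]; last by rewrite /top -ltnS xm.
apply/negP => vF; have := Fm (val v); rewrite occ_mem vF => /(_ isT) /=; lia.
Qed.

(** Without [v], the positions m + 1, ..., n are free and can host one interval, which leaves k
    intervals for [0, m]. *)
Lemma del_top (F : {set 'I_n.+1}) : (F \in faces (del (Z := D1) v)) = (F \in faces Dm1).
Proof.
rewrite [LHS]inE; apply/andP/packingP.
  move=> [vF /packingP[Ft pF]]; split; first by apply/top_notin.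
  by have := pack_drop pF; rewrite subSn ?leq_addl // addnK.
move=> [/top_notin[vF Ft] pF]; split=> //; apply/packingP; split=> //.
apply: (@pack_add t k m.+1) => // x /andP[mx xn]; apply/negP => xF.
by have := proj1 (top_notin F) (conj vF Ft) x xF; rewrite ltnNge mx.
Qed.

Lemma lk_top (F : {set 'I_n.+1}) : (F \in faces (lk (Z := D1) v)) = (F \in faces E).
Proof.
rewrite [LHS]inE; apply/andP/packingP.
  move=> [vF /packingP[Ft pF]].
  have Ft' x : occ F x -> top x by move=> xF; apply: Ft; rewrite occU1 xF orbT.
  split; first by apply/top_notin.
  apply: (pack_trim_sub (y := n) _ _ _ pF) => [||x xF]; [|lia|].
    by rewrite occU1 eqxx.
  by rewrite occU1 xF orbT.
move=> [/top_notin[vF Ft] pF]; split=> //; apply/packingP; split=> [x|].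
  by rewrite occU1 => /orP[/eqP ->|/Ft //]; rewrite /top eqxx orbT.
apply: pack_sub pF => // x xn; by rewrite occU1 /= (ltn_eqF xn).
Qed.

Let wo : w != o.
Proof. by rewrite -val_eqE /= -lt0n. Qed.

Lemma low_link_star (F : {set 'I_n.+1}) : w \notin F -> (w |: F)%SET \in faces E ->
  (o |: F)%SET \in faces E.
Proof.
move=> wF /packingP[Fm pF]; apply/packingP; split=> [x|].
  by rewrite occU1 => /orP[/eqP ->|xF] //; apply: Fm; rewrite occU1 xF orbT.
have /(pack_first t_gt0) pm : pack t k.+1 m (occ (w |: F)%SET).
  by apply: pack_trim pF; rewrite ?occU1 ?eqxx.
(* Freeing 0 has cost one interval. It is replaced by m, ..., m + t - 1, which avoids [F] because
   [F] stays at or below m and misses [w]. *)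
apply: pack_add => [x /andP[mx xn]|]; last first.
  by apply: pack_sub pm => // x xm; rewrite !occU1 /= => /orP[->|->]; rewrite ?orbT.
rewrite occU1 /= (gtn_eqF (leq_trans m_gt0 mx)) /=; apply/negP => xF.
have := Fm x; rewrite occU1 xF orbT => /(_ isT) xm.
case/occP: xF => y yF yx; move: wF; rewrite (_ : w = y) ?yF //; apply: val_inj.
by rewrite yx /=; apply/eqP; rewrite eqn_leq mx -ltnS xm.
Qed.

Let Dk := packing t n.+1 (fun x => x < m)%N k m.
Let Dk1 := packing t n.+1 (fun x => x < m)%N k.+1 m.

Lemma low_notin (F : {set 'I_n.+1}) :
  (w \notin F) /\ (forall x, occ F x -> (x < m.+1)%N) <->
  (forall x, occ F x -> (x < m)%N).
Proof.
split=> [[wF Fm] x xF|Fm].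
  have := Fm _ xF; rewrite ltnS leq_eqVlt => /orP[/eqP xm|//].
  by case/occP: xF => y yF yx; move: wF; rewrite (_ : w = y) ?yF //; apply: val_inj;
    rewrite yx xm.
split=> [|x /Fm xm]; last exact: ltnW.
by apply/negP => wF; have := Fm (val w); rewrite occ_mem wF ltnn => /(_ isT).
Qed.

Lemma del_low (F : {set 'I_n.+1}) : (F \in faces (del (Z := E) w)) = (F \in faces Dk).
Proof.
rewrite [LHS]inE; apply/andP/packingP.
  move=> [wF /packingP[Fm pF]]; split; first by apply/low_notin.
  by have := pack_drop pF; rewrite addnK.
move=> [/low_notin[wF Fm] pF]; split=> //; apply/packingP; split=> //.
apply: pack_add => // x /andP[mx xn]; apply/negP => xF.
by have := proj1 (low_notin F) (conj wF Fm) x xF; rewrite ltnNge mx.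
Qed.

(** Inside [0, m + t), an interval of length t that avoids m ends before m, so all the k + 1
    intervals lie in [0, m). *)
Lemma lk_low (F : {set 'I_n.+1}) : (F \in faces (lk (Z := E) w)) = (F \in faces Dk1).
Proof.
rewrite [LHS]inE; apply/andP/packingP.
  move=> [wF /packingP[Fm pF]].
  have Fm' x : occ F x -> (x < m.+1)%N.
    by move=> xF; apply: Fm; rewrite occU1 xF orbT.
  split; first by apply/low_notin.
  apply: (pack_trim_sub (y := m) _ _ _ pF) => // [|x xF].
    by rewrite occU1 eqxx.
  by rewrite occU1 xF orbT.
move=> [/low_notin[wF Fm] pF]; split=> //; apply/packingP; split=> [x|].
  by rewrite occU1 => /orP[/eqP ->|/Fm //] /=.
by apply: pack_sub pF; rewrite ?leq_addr // => x xm; rewrite occU1 /= (ltn_eqF xm).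
Qed.

Let mn1 : (m.+1 <= n.+1)%N. Proof. by rewrite ltnS leq_addr. Qed.

Let pack_empty : pack t k.+1 m (fun=> false).
Proof. exact: pack_free. Qed.

Let hDw : [set w]%SET \in faces Dm1.
Proof.
apply/packingP; split=> [x|]; first by rewrite occ1 => /eqP ->; rewrite /= ltnSn.
have p : pack t k m (occ [set w]%SET).
  by apply: pack_free => [|x xm]; [lia|rewrite occ1 /= (ltn_eqF xm)].
by apply: pack_sub p.
Qed.

Let hw' : [set w]%SET \in faces (del (Z := D1) v).
Proof. by rewrite del_top. Qed.

Let hwE : [set w]%SET \in faces E.
Proof.
apply/packingP; split=> [x|]; first by rewrite occ1 => /eqP ->; rewrite /= ltnSn.
have p : pack t k.+1 m (occ [set w]%SET).
  by apply: pack_free => // x xm; rewrite occ1 /= (ltn_eqF xm).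
by apply: pack_sub p; rewrite ?leq_addr.
Qed.

Let ho : [set o]%SET \in faces E.
Proof.
have := @low_link_star finset.set0; rewrite !finset.setU0; apply; last exact: hwE.
by rewrite finset.in_set0.
Qed.

Let hoD : [set o]%SET \in faces Dk.
Proof.
apply/packingP; split=> [x|]; first by rewrite occ1 => /eqP ->.
by apply: pack_sub (pack_first t_gt0 pack_empty) => // x _; rewrite occ1 orbF.
Qed.

Let ho' : [set o]%SET \in faces (del (Z := E) w).
Proof. by rewrite del_low. Qed.

Lemma pack_complex_rec (hp : [set ord_max]%SET \in faces (pack_complex t (m + t).+1 k.+1))
    (hq : [set ord_max]%SET \in faces (pack_complex t m.+1 k)) :
  pequiv (PCx hp) (Att (Att (PCx hq) (pack_complex t m k)) (susp (pack_complex t m k.+1))).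
Proof.
apply: pe_trans (pack_complex_top hp) _.
apply: pe_trans (pe_base hv hw top_edge) _.
apply: pe_trans (@cone_attach D1 v w vw top_link_star hw hw') _.
apply: (@pe_trans _ (att hDw E)).
  apply: (@att_iso (del (Z := D1) v) Dm1 id (lk (Z := D1) v) E id) => //;
    apply: embeds_eq => F.
    exact: del_top.
  exact: lk_top.
have [f fe fE] := packing_embeds t k mn1.
apply: (@pe_trans _ (Att (PCx hq) E)).
  apply: pe_sym; apply: (@att_iso _ _ f E E id) => //; first exact: embeds_id.
  by apply: val_inj; rewrite fE.
(* The base point [o] of [E] serves only to rewrite [E] inside the attachment; [Att_Att] then
   separates its two parts. *)
apply: (@pe_trans _ (Att (PCx hq) (cx (Att (PCx hoD) Dk1)))).
  apply: (@Att_congr_r _ (PCx ho)).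
  apply: pe_trans (@cone_attach E w o wo low_link_star ho ho') _.
  apply: (@att_iso (del (Z := E) w) Dk id (lk (Z := E) w) Dk1 id) => //;
    apply: embeds_eq => F.
    exact: del_low.
  exact: lk_low.
apply: pe_trans (Att_Att _ _ _) _.
have [g ge _] := packing_embeds t k (leqW (leq_addr t m)).
have [g1 ge1 _] := packing_embeds t k.+1 (leqW (leq_addr t m)).
apply: pe_sym; apply: (@pe_trans _ (Att (Att (PCx hq) Dk) (susp (pack_complex t m k.+1)))).
  by apply: Att_congr_l; apply: Att_embeds ge.
by apply: Att_embeds (susp_embeds ge1).
Qed.

End Recursion.

(** * Packings and the faces of the Alexander dual *)

Lemma pack_starts t k (s : 'I_k -> nat) n (A : nat -> bool) :
  (0 < t)%N -> (forall a, (s a + t <= n)%N) ->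
  (forall a x, (s a <= x < s a + t)%N -> ~~ A x) ->
  (forall a b, a != b -> (s a + t <= s b)%N \/ (s b + t <= s a)%N) ->
  pack t k n A.
Proof.
move=> t_gt0; elim: k s n => //= k IH s n sn sA sd.
(* The family comes in no particular order. The interval with the largest start is taken as the last
   one; the others, disjoint from it, end before it. *)
have [a _ smax] := @arg_maxnP _ ord0 xpredT s isT.
exists (s a); split=> // [x|]; first exact: sA.
apply: (IH (s \o lift a)) => [b|b x|b c bc] /=.
- have ab : a != lift a b by exact: neq_lift.
  have [H|//] := sd _ _ ab; have := smax (lift a b) isT; rewrite /=; lia.
- exact: sA.
- by apply: sd; rewrite (inj_eq lift_inj).
Qed.

Lemma starts_pack t k n (A : nat -> bool) : pack t k n A ->
  exists s : nat -> nat, [/\ forall a, (a < k)%N -> (s a + t <= n)%N,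
    forall a, (a < k)%N -> forall x, (s a <= x < s a + t)%N -> ~~ A x &
    forall a b, (a < b < k)%N -> (s a + t <= s b)%N].
Proof.
elim: k n => [|k IH] n /=; first by move=> _; exists id; split=> // a b; lia.
move=> [i [it Ai /IH[s [sn sA sd]]]]; exists (fun a => if (a < k)%N then s a else i).
split.
- move=> a _; case: ifP => [ak|_] //; have := sn _ ak; lia.
- by move=> a _; case: ifP => [ak|_] //; exact: sA.
- move=> a b /andP[ab bk]; have ak : (a < k)%N by lia.
  rewrite ak; case: ifP => [bk'|_]; first by apply: sd; rewrite ab.
  exact: sn.
Qed.

Section DeltaFaces.
Variables (K : fieldType) (m t : nat).
Hypothesis t_gt0 : (0 < t)%N.

Definition path_family k (G : {set 'I_m}) (e : 'I_k -> {set 'I_m}) : Prop :=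
  [/\ forall a, t_path t (e a), forall a b, a != b -> [disjoint e a & e b]%B &
    forall a, e a \subset G].

Lemma path_family_pack k (F : {set 'I_m}) :
  (exists e, @path_family k (~: F)%SET e) <-> pack t k m (occ F).
Proof.
split=> [[e [et ed eF]]|/starts_pack[s [sn sA sd]]].
- pose s a := projT1 (cid2 (et a)).
  have sm a : (s a + t <= m)%N by rewrite /s; case: (cid2 _).
  have se a : e a = [set x : 'I_m | (s a <= x < s a + t)%N]%SET.
    by rewrite /s; case: (cid2 _).
  apply: (pack_starts (s := s)) => // [a x xa|a b ab].
    have xm : (x < m)%N by have := sm a; lia.
    have := fintype.subsetP (eF a) (Ordinal xm); rewrite se !inE => /(_ xa).
    by rewrite -occ_mem.
  case: (leqP (s a + t) (s b)) => [|ba]; first by left.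
  case: (leqP (s b + t) (s a)) => [|ab']; first by right.
  have /pred0P dab := ed _ _ ab.
  (* If neither interval ends before the other begins, both contain the larger of the two starts. *)
  have cm : (maxn (s a) (s b) < m)%N by have := sm a; have := sm b; lia.
  by have := dab (Ordinal cm); rewrite /= !se !inE /=; lia.
- exists (fun a => [set x : 'I_m | (s a <= x < s a + t)%N]%SET); split.
  + by move=> a; exists (s a) => //; apply: sn.
  + move=> a b ab; apply/pred0P => x /=; rewrite !inE.
    have [lt|lt|/val_inj e] := ltngtP a b; last by rewrite e eqxx in ab.
      have := sd a b; rewrite lt ltn_ord => /(_ isT); lia.
    have := sd b a; rewrite lt ltn_ord => /(_ isT); lia.
  + move=> a; apply/fintype.subsetP => x; rewrite !inE => xa.
    by rewrite -occ_mem; apply: sA xa.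
Qed.

Definition indicator (G : {set 'I_m}) (i : 'I_m) : K := (i \in G)%:R.

Lemma meval_mono (G F : {set 'I_m}) :
  mpoly.meval (indicator G) (mono K F) = (F \subset G)%:R.
Proof.
rewrite /mono rmorph_prod /=.
under eq_bigr do rewrite mpoly.mevalXU.
case: (boolP (F \subset G)) => [/fintype.subsetP FG|/fintype.subsetPn[x xF xG]].
  by rewrite big1 // => i /FG iG; rewrite /indicator iG.
by rewrite (bigD1 x) //= /indicator (negbTE xG) mul0r.
Qed.

(* The evaluation at the indicator of G kills every generator whose support is
   not contained in G, but not the monomial of G. *)
Lemma mono_in_power k (G : {set 'I_m}) :
  ideal_gen (sqfree_power_gens K m t k) (mono K G) <->
  exists e, @path_family k G e.
Proof.
split=> [[s [sS sG]]|[e [et ed eG]]].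
- apply: contrapT => H.
  have : mpoly.meval (indicator G) (mono K G) = 0.
    rewrite sG rmorph_sum /= big_seq big1 // => x /sS[e [et ed ->]].
    rewrite rmorphM rmorph_prod /=.
    have [a ea] : exists a, ~~ (e a \subset G).
      apply: contrapT => H'; apply: H; exists e; split=> // a.
      by apply: contrapT => /negP ea; apply: H'; exists a.
    by rewrite (bigD1 a) //= meval_mono (negbTE ea) mul0r mulr0.
  by rewrite meval_mono fintype.subxx; apply/eqP; exact: oner_neq0.
- pose U := (\bigcup_(a < k) e a)%SET.
  have UG : U \subset G by apply/bigcupsP => a _; exact: eG.
  rewrite (mono_subset K UG); apply: ideal_gen_mull.
  exists [:: (1, mono K U)]; split; last by rewrite big_seq1 mul1r.
  move=> x; rewrite inE => /eqP -> /=; exists e; split => //.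
  by rewrite /mono /U partition_disjoint_bigcup.
Qed.

(** A face of the dual is the complement of a nonface: the monomial of the complement of [F] lies in
    the squarefree power, which by [mono_in_power] means that k + 1 disjoint paths avoid [F]. *)
Lemma mem_Delta k (F : {set 'I_m}) :
  reflect (pack t k.+1 m (occ F)) (F \in faces (Delta K m t k.+1)).
Proof.
apply: (iffP imsetP) => [[G GS ->]|pF].
  apply/path_family_pack; rewrite finset.setCK; apply/mono_in_power.
  by move: GS; rewrite inE /= inE negbK => /asboolP.
exists (~: F)%SET; last by rewrite finset.setCK.
rewrite inE /= inE negbK; apply/asboolP/mono_in_power.
exact/path_family_pack.
Qed.

Lemma Delta_embeds k :
  exists f : ground (pack_complex t m k) -> ground (Delta K m t k), embeds f.
Proof.
case: k => [|k]; exists id; apply: embeds_eq => F.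
  by rewrite !inE; apply/packedP.
by apply/packingP/mem_Delta => [[]|].
Qed.

End DeltaFaces.

(** * Directed paths *)

Section Runs.
Variables (t : nat).

(* The directed paths from u to the terminal vertices (m, j) with j > 0; f is
   fuel.  The targets are reversed because fold_att attaches the last complex of
   a list first. *)
Fixpoint runs (f : nat) (u : nat * nat) : seq (seq (nat * nat)) :=
  if f is f'.+1 then
    if u.2 == 0%N then [::] else
    if (u.1 <= u.2 * t + t)%N then [:: [::]] else
    flatten [seq [seq v :: p | p <- runs f' v] | v <- rev (targets t u)]
  else [::].

Lemma runsS f u : runs f.+1 u = if u.2 == 0%N then [::] else
  if (u.1 <= u.2 * t + t)%N then [:: [::]] else
  [seq v :: p | v <- rev (targets t u), p <- runs f v].
Proof. by []. Qed.

Definition run_type (u : nat * nat) (p : seq (nat * nat)) : nat * nat * nat :=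
  (last u p, sumn (pairmap (label t) u p)).

(** The list of the summands for the start [u], a triple being repeated once for each path that
    yields it; see [count_dec]. *)
Definition dec (f : nat) (u : nat * nat) : seq (nat * nat * nat) :=
  [seq run_type u p | p <- runs f u].

Definition add_susp (a : nat) (x : nat * nat * nat) : nat * nat * nat := (x.1, x.2 + a)%N.

Hypothesis t_gt0 : (0 < t)%N.

(** Labels are computed as indices in [targets], so a repeated target would be given the smaller
    label. *)
Lemma targets_uniq u : (0 < u.2)%N -> (u.2 * t + t < u.1)%N -> uniq (targets t u).
Proof.
case: u => m [//|j] /= _ mt; rewrite !inE !xpair_eqE /= !andbT; lia.
Qed.

Lemma run_type_cons u v p : run_type u (v :: p) = add_susp (label t u v) (run_type v p).
Proof. by rewrite /run_type /add_susp /= addnC. Qed.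

Lemma dec0 f m : dec f (m, 0%N) = [::].
Proof. by case: f. Qed.

Lemma dec_terminal f m j : (0 < j)%N -> (m <= j * t + t)%N ->
  dec f.+1 (m, j) = [:: (m, j, 0%N)].
Proof. by case: j => // j _ mj; rewrite /dec /= mj. Qed.

Lemma dec_rec f m j : (j.+1 * t + t < m)%N ->
  dec f.+1 (m, j.+1) = [seq add_susp 2 x | x <- dec f (m - t.+1, j.+1)%N] ++
    [seq add_susp 1 x | x <- dec f (m - t.+1, j)%N] ++ dec f (m - t, j)%N.
Proof.
move=> mj; have /= := @targets_uniq (m, j.+1) isT mj.
rewrite !inE negb_or => /and3P[/andP[ab ac] bc _].
rewrite /dec /= leqNgt mj /= /rev /= cats0 !map_cat -!map_comp.
congr (_ ++ (_ ++ _)); apply: eq_map => p; rewrite /= run_type_cons /label /=.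
- by rewrite (negbTE ac) (negbTE bc) eqxx.
- by rewrite (negbTE ab) eqxx.
- by rewrite eqxx /add_susp addn0; case: (run_type _ _).
Qed.

Lemma runs_uniq f u : uniq (runs f u).
Proof.
elim: f u => // f IH u; rewrite runsS; case: eqP => // /eqP; rewrite -lt0n => u2.
case: leqP => // mt; apply: (@allpairs_uniq_dep _ (fun=> seq (nat * nat)) _
  (fun v p => v :: p) (rev (targets t u)) (runs f)).
- by rewrite rev_uniq targets_uniq.
- by move=> v _; exact: IH.
- by move=> [v p] [v' p'] _ _ [/= -> ->].
Qed.

(** Each edge lowers [u.1 + u.2], so the fuel does not run out. A vertex with j > 0 has outgoing
    edges exactly when m > j * t + t; the paths to be counted are thus those that stop with j > 0
    because they cannot be continued, as [runs] enumerates them. *)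
Lemma mem_runs f n k u p : (u.1 + u.2 < f)%N -> is_vertex n k t u ->
  (p \in runs f u) = [&& all (is_vertex n k t) p, path (edge n k t) u p,
    (0 < (last u p).2)%N & ((last u p).1 <= (last u p).2 * t + t)%N].
Proof.
elim: f u p => // f IH u p uf uV; rewrite runsS; case: eqP => [u0|/eqP].
  rewrite in_nil; symmetry; apply/negP.
  case: p => [|v p] /=; first by rewrite u0.
  by rewrite /edge u0 ltnn andbF andbF.
rewrite -lt0n => u2; case: (leqP u.1 (u.2 * t + t)) => mt.
  rewrite inE; case: p => [|v p] /=; first by rewrite u2 mt.
  have -> : edge n k t u v = false by rewrite /edge; lia.
  by rewrite andbF.
apply/(@allpairsPdep _ (fun=> seq (nat * nat)) _ (fun v p => v :: p)
  (rev (targets t u)) (runs f))/idP => [[v [q [vu qv ->]]]|].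
  rewrite mem_rev in vu.
  have vf : (v.1 + v.2 < f)%N.
    by move: vu; rewrite !inE => /or3P[]/eqP-> /=; lia.
  have vV : is_vertex n k t v.
    move: uV; rewrite /is_vertex; case: (u) u2 mt vu => m [//|j] /= _ mt.
    by rewrite !inE => /or3P[]/eqP-> /=; nia.
  move: qv; rewrite IH // => /and4P[qV qp q0 qt].
  by rewrite /= vV qV qp q0 qt /edge uV u2 vu /= !andbT addn1 mt.
case: p => [|v q] /=; first by rewrite u2 leqNgt mt.
case/and4P=> /andP[vV qV] /andP[/and4P[_ _ _ vu] qp] q0 qt; exists v, q.
rewrite mem_rev vu; split=> //; rewrite IH // ?qV ?qp ?q0 ?qt //.
by move: vu; rewrite !inE => /or3P[]/eqP-> /=; lia.
Qed.

Lemma count_dec n k x : (0 < x.1.2)%N -> (x.1.1 <= x.1.2 * t + t)%N ->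
  (t < n - k * t)%N ->
  count_mem x (dec (n + k).+1 (n, k)) = npaths n k t x.1.1 x.1.2 x.2.
Proof.
move=> x0 xt nk; have uV : is_vertex n k t (n, k).
  by rewrite /is_vertex /=; lia.
pose s := [seq p <- runs (n + k).+1 (n, k) | run_type (n, k) p == x].
rewrite /dec count_map -size_filter -/s /npaths.
have -> : size s = #|` seq_fset tt s|.
  by rewrite size_seq_fset undup_id // filter_uniq // runs_uniq.
congr (size _); congr enum_fset; apply/fsetP => p.
rewrite seq_fsetE mem_filter (@mem_runs _ n k) // in_fset_set; last exact: finite_dipaths.
apply/idP/idP.
  move=> /andP[/eqP xE /and4P[pV pp _ _]]; rewrite inE; split=> //=.
  - by rewrite uV.
  - by rewrite -xE /=; case: (last _ _).
  - by rewrite -xE.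
rewrite inE => -[/andP[_ pV] pp lp sp]; apply/andP; split.
  by rewrite /run_type lp sp; case: x {x0 xt lp sp s} => -[].
by apply/and4P; split=> //; rewrite lp.
Qed.

Lemma dec_admissible n k x : (t < n - k * t)%N ->
  x \in dec (n + k).+1 (n, k) -> admissible k t x.
Proof.
move=> nk /mapP[p]; have uV : is_vertex n k t (n, k).
  by rewrite /is_vertex /=; lia.
rewrite (@mem_runs _ n k) // => /and4P[pV pp l0 lt] ->.
have : is_vertex n k t (last (n, k) p).
  have : last (n, k) p \in (n, k) :: p by exact: mem_last.
  rewrite inE => /orP[/eqP -> //|]; exact: (allP pV).
rewrite /run_type /is_vertex /=; case: (last _ _) l0 lt => m j /= *; lia.
Qed.

End Runs.

(** * The decomposition *)

Section Decomposition.
Variables (K : fieldType) (t : nat).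
Hypothesis t_gt0 : (0 < t)%N.

Definition piece (a : nat) (x : nat * nat * nat) : scomplex :=
  iter (x.2 + a) susp (Delta K x.1.1 t x.1.2).

Lemma map_susp_piece a s :
  [seq susp X | X <- [seq piece a x | x <- s]] = [seq piece a.+1 x | x <- s].
Proof. by rewrite -map_comp; apply: eq_map => x; rewrite /piece addnS. Qed.

Lemma piece_add_susp b s :
  [seq piece 0 x | x <- [seq add_susp b x | x <- s]] = [seq piece b x | x <- s].
Proof. by rewrite -map_comp; apply: eq_map => x; rewrite /piece /= addn0. Qed.

(** Compensates for the suspension that [Att] performs on whatever it attaches. *)
Definition drop_susp (x : nat * nat * nat) : nat * nat * nat := (x.1, x.2.-1).

Lemma drop_add_susp b s :
  [seq drop_susp x | x <- [seq add_susp b.+1 x | x <- s]] = [seq add_susp b x | x <- s].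
Proof. by rewrite -map_comp; apply: eq_map => x; rewrite /drop_susp /= addnS. Qed.

Lemma piece_drop_susp s : all (fun x => 0 < x.2)%N s ->
  [seq piece 1 x | x <- [seq drop_susp x | x <- s]] = [seq piece 0 x | x <- s].
Proof.
move=> /allP s0; rewrite -map_comp; apply/eq_in_map => -[y a] /s0 /= a0.
by rewrite /piece /= addn0 addn1 prednK.
Qed.

Lemma pack_complex0 m (hp : [set ord_max]%SET \in faces (pack_complex t m.+1 0)) :
  pequiv (PCx hp) one_point.
Proof. by apply: cone_point => S _; apply/packingP; split. Qed.

Lemma set0_pack_complex m j : (j * t <= m)%N -> finset.set0 \in faces (pack_complex t m j).
Proof.
move=> jm; apply/packingP; split=> [x|]; first by rewrite occ0.
by apply: pack_free => // x _; rewrite occ0.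
Qed.

(** Formulated for attachments because a terminal complex may lack a vertex to serve as base
    point. *)
Definition attaches f m j := forall P,
  pequiv (Att P (pack_complex t m j)) (fold_att P [seq piece 0 x | x <- dec t f (m, j)]).

(** Positivity of every alpha is carried along so that [drop_susp] can be undone after
    suspending. *)
Definition decomposes f m j := forall hp : [set ord_max]%SET \in faces (pack_complex t m.+1 j),
  pequiv (PCx hp) (fold_att one_point [seq piece 0 (drop_susp x) | x <- dec t f (m.+1, j)]) /\
  all (fun x => 0 < x.2)%N (dec t f (m.+1, j)).

Lemma attaches_susp f m j P : (j * t <= m)%N -> attaches f m j ->
  pequiv (Att P (susp (pack_complex t m j)))
    (fold_att P [seq piece 1 x | x <- dec t f (m, j)]).
Proof.
move=> jm am; apply: pe_trans (Att_embeds P (susp_att_embeds (set0_pack_complex jm))) _.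
by apply: pe_trans (Att_congr_r P (am one_point)) _; rewrite -map_susp_piece; exact: Att_fold.
Qed.

(** The two statements are proved together by induction on the fuel; attaching a complex beyond the
    terminal range is deduced from its decomposition at the same fuel. The condition [0 < m]
    excludes the simplex without vertices, whose suspension is two points rather than
    contractible. *)
Lemma decomposition f :
  (forall m j, (m + j < f)%N -> (0 < m)%N -> (j * t <= m)%N -> attaches f m j) /\
  (forall m j, (m.+1 + j < f)%N -> (j * t + t < m.+1)%N -> decomposes f m j).
Proof.
elim: f => [|f [IHa IHd]]; first by split.
have dec_step m j : (m.+1 + j < f.+1)%N -> (j * t + t < m.+1)%N -> decomposes f.+1 m j.
  case: j => [|j] mf jm hp; first by rewrite dec0; split=> //; exact: pack_complex0.
  have [m' mE] : exists m', m = (m' + t)%N by exists (m - t)%N; rewrite subnK //; lia.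
  subst m; have jm' : (j.+1 * t <= m')%N by lia.
  have jm0 : (j * t <= m')%N by apply: leq_trans jm'; rewrite mulSn leq_addl.
  have m'0 : (0 < m')%N by apply: leq_trans jm'; rewrite mulSn ltn_addr.
  have hq := pack_complex_base jm0.
  have E1 : ((m' + t).+1 - t.+1 = m')%N by rewrite subSS addnK.
  have E2 : ((m' + t).+1 - t = m'.+1)%N by rewrite -addSn addnK.
  (* The target with label 0 never falls in the terminal range, as (j + 1) * t <= m' gives j * t + t
     < m' + 1. It supplies the pointed complex to which the other two, possibly terminal, are
     attached. *)
  have /(_ hq)[d0 pos0] : decomposes f m' j by apply: IHd; lia.
  have a1 : attaches f m' j by apply: IHa => //; lia.
  have a2 : attaches f m' j.+1 by apply: IHa => //; lia.
  rewrite dec_rec // E1 E2; split; last first.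
    rewrite !all_cat pos0 andbT; apply/andP; split;
    by apply/allP => _ /mapP[x _ ->]; rewrite /add_susp /= ?addn1 ?addn2.
  apply: pe_trans (pack_complex_rec t_gt0 jm' hp hq) _.
  apply: pe_trans (attaches_susp _ jm' a2) _.
  rewrite (map_comp (piece 0) drop_susp) !map_cat !drop_add_susp piece_add_susp.
  rewrite (_ : [seq add_susp 0 x | x <- dec t f (m', j)] = dec t f (m', j)); last first.
    by rewrite -[RHS]map_id; apply: eq_map => -[y a]; rewrite /add_susp /= addn0.
  rewrite -map_comp !fold_att_cat; apply: fold_att_congr.
  apply: pe_trans (a1 _) _; apply: fold_att_congr; exact: d0.
split=> // m j mf m_gt0 jm P.
case: (posnP j) => [j0|j_gt0].
  subst j; rewrite dec0; case: m {mf jm} m_gt0 => // m _.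
  (* For j = 0 the complex is a full simplex, hence contractible, and no path reaches a vertex with
     j > 0: both sides leave [P] as it is. *)
  have hp : [set ord_max]%SET \in faces (pack_complex t m.+1 0) by exact: pack_complex_base.
  apply: pe_trans (Att_congr_r P (pack_complex0 hp)) _; exact: Att_one_point.
case: (leqP m (j * t + t)) => mj.
  rewrite dec_terminal //=; have [g ge] := Delta_embeds K m t_gt0 j.
  exact: Att_embeds ge.
case: m mf jm mj m_gt0 => // m mf jm mj _.
have hp : [set ord_max]%SET \in faces (pack_complex t m.+1 j) by apply: pack_complex_base; lia.
have [d pos] := dec_step m j mf mj hp.
apply: pe_trans (Att_congr_r P d) _.
apply: pe_trans (Att_fold _ _) _.
by rewrite (map_comp (piece 0) drop_susp) map_susp_piece piece_drop_susp //; exact: pequiv_refl.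
Qed.

End Decomposition.

(** * Matching the pieces of the bouquet with the indices of the wedge *)

Lemma size_positions (T : eqType) (s : seq T) (x0 x : T) :
  size [seq i <- iota 0 (size s) | nth x0 s i == x] = count_mem x s.
Proof. by rewrite size_filter -[in RHS](mkseq_nth x0 s) /mkseq count_map. Qed.

Lemma nth_bijection (T : choiceType) (s : seq T) (x0 x : T) (c : nat) :
  (c < count_mem x s)%N ->
  let l := [seq i <- iota 0 (size s) | nth x0 s i == x] in
  (nth 0%N l c < size s)%N /\ nth x0 s (nth 0%N l c) = x.
Proof.
move=> cx l; have sl : size l = count_mem x s by exact: size_positions.
have : nth 0%N l c \in l by rewrite mem_nth // sl.
by rewrite mem_filter mem_iota => /andP[/eqP -> /andP[_]].
Qed.

Section Final.
Variables (R : realType) (K : fieldType) (n k t : nat).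
Hypotheses (t_gt0 : (0 < t)%N) (hn : (t < n - k * t)%N).

Let s := dec t (n + k).+1 (n, k).
Let x0 : nat * nat * nat := (0%N, 0%N, 0%N).
Let cs := [seq piece K t 0 (drop_susp x) | x <- s].

Lemma windex_count (i : windex n k t) : count_mem (val (tag i)) s =
  npaths n k t (val (tag i)).1.1 (val (tag i)).1.2 (val (tag i)).2.
Proof.
case: i => -[[[m j] a] /= adm] c /=; apply: count_dec => //=; lia.
Qed.

(** The copy numbered c of a triple goes to the occurrence numbered c of that triple in [s]; by
    [count_dec] this is a bijection onto the positions of [s]. *)
Definition place (i : windex n k t) : nat :=
  nth 0%N [seq l <- iota 0 (size s) | nth x0 s l == val (tag i)] (tagged i).

Lemma placeP i : (place i < size s)%N /\ nth x0 s (place i) = val (tag i).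
Proof. by apply: nth_bijection; rewrite windex_count; exact: ltn_ord. Qed.

Lemma place_inj : injective place.
Proof.
move=> i i' ii'; have [_] := placeP i; rewrite ii' (placeP i').2 => /val_inj.
case: i i' ii' => [x c] [x' c'] /= + e; subst x' => cc; congr existT; apply/val_inj.
move/eqP: cc; rewrite /place /= nth_uniq ?filter_uniq ?iota_uniq //; first by move/eqP.
all: rewrite size_positions.
all: by rewrite (windex_count (existT _ x c)) ltn_ord.
Qed.

Lemma place_surj l : (l < size s)%N -> exists i, place i = l.
Proof.
move=> ls; have xs := mem_nth x0 ls.
have adm := dec_admissible t_gt0 hn xs.
have [j0 mj] : (0 < (nth x0 s l).1.2)%N /\
    ((nth x0 s l).1.1 <= (nth x0 s l).1.2 * t + t)%N.
  by move: (nth x0 s l) adm => -[[m j] a] /= /and3P[/andP[-> _] _ ->].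
pose x : {x : nat * nat * nat | admissible k t x} := Sub (nth x0 s l) adm.
pose L := [seq l' <- iota 0 (size s) | nth x0 s l' == nth x0 s l].
have lL : l \in L by rewrite mem_filter eqxx mem_iota.
have cL : (index l L < npaths n k t (val x).1.1 (val x).1.2 (val x).2)%N.
  have <- : size L = npaths n k t (val x).1.1 (val x).1.2 (val x).2.
    by rewrite size_positions; apply: count_dec.
  by rewrite index_mem.
exists (existT _ x (Ordinal cL)); rewrite /place /=; exact: nth_index.
Qed.

Lemma windex_finite : finite_set [set: windex n k t].
Proof.
have -> : [set: windex n k t] = place @^-1` `I_(size s).
  by apply/seteqP; split=> // i _; exact: (placeP i).1.
apply: finite_preimage; last exact: finite_II.
by move=> i i' _ _; exact: place_inj.
Qed.

Let X0 : scomplex := cx one_point.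
Let W := fold_att one_point cs.

Lemma cs_set0 l : (l < size cs)%N -> finset.set0 \in faces (nth X0 cs l).
Proof.
rewrite size_map => ls; rewrite (nth_map x0) //.
have := dec_admissible t_gt0 hn (mem_nth x0 ls).
move: (nth x0 s l) => [[m j] a] /= /and3P[_ jm _].
by apply: set0_iter_susp; exact: set0_Delta.
Qed.

(** The equality of complexes is not definitional, so the vertex map has to be cast. Eliminating the
    equality while [X] is a variable avoids any computation with casts. *)
Lemma into_fold_transport l (X : scomplex) : nth X0 cs l = X ->
  exists g : ground (susp X) -> ground (cx W), [/\
    injective g <-> injective (@into_fold X0 cs l),
    g (north X) = @into_fold X0 cs l (north _),
    forall S : {set ground (cx W)},
      (exists2 T, T \in faces (susp X) & S = (g @: T)%SET) <->
      (exists2 T, T \in faces (susp (nth X0 cs l)) & S = (@into_fold X0 cs l @: T)%SET) &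
    forall x, exists y, g x = @into_fold X0 cs l y].
Proof. by move=> <-; exists (@into_fold X0 cs l); split=> // x; exists x. Qed.

(** All that [bouquet] needs is gathered in one existential, so that the cast occurs only once. The
    base point of a summand is the pole [inr true], which [into_fold] sends to the base of [W]. *)
Lemma summand_into (i : windex n k t) :
  exists bg : {b : ground (summand_complex K t (val (tag i))) &
      ground (summand_complex K t (val (tag i))) -> ground (cx W)},
    let b := projT1 bg in let g := projT2 bg in
    [/\ weight (summand_base R K hn i) = vertex_fun R b,
      injective g <-> injective (@into_fold X0 cs (place i)),
      g b = @into_fold X0 cs (place i) (north _),
      forall S : {set ground (cx W)},
        (exists2 T, T \in faces (summand_complex K t (val (tag i))) & S = (g @: T)%SET) <->
        (exists2 T, T \in faces (susp (nth X0 cs (place i))) &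
          S = (@into_fold X0 cs (place i) @: T)%SET) &
      forall x, exists y, g x = @into_fold X0 cs (place i) y].
Proof.
have [ps px] := placeP i; move: (place i) ps px => l ls.
(* Generalizing the proof of positivity allows alpha to be destructed as a successor, which lets
   [iter_pole] reduce. *)
rewrite /summand_base; move: (windex_alpha_gt0 hn i).
case: i => -[[[m j] [//|a]] /= adm] c /= a0 px.
have lX : nth X0 cs l = iter a susp (Delta K m t j).
  by rewrite (nth_map x0) // px /piece /= addn0.
have [g [gi gb gf gx]] := into_fold_transport lX.
by exists (existT _ (north _) g); split.
Qed.

Let b (i : windex n k t) := projT1 (projT1 (cid (summand_into i))).
Let g (i : windex n k t) := projT2 (projT1 (cid (summand_into i))).

Lemma windex_bouquet : @bouquet W (windex n k t)
  (fun i => summand_complex K t (val (tag i))) b g.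
Proof.
have [inj fb dis fT Tf] := fold_bouquet cs_set0.
have ps i : (place i < size cs)%N by rewrite size_map; exact: (placeP i).1.
pose pos i : {l : nat | (l < size cs)%N} := exist _ (place i) (ps i).
split=> [i|i|i i' x y ii'|i T TY|S].
- rewrite /g; case: (cid _) => /= bg [_ gi _ _ _]; apply/gi.
  exact: (inj (pos i)).
- rewrite /g /b; case: (cid _) => /= bg [_ _ -> _ _].
  exact: (fb (pos i)).
- rewrite /g; case: (cid _) => /= bg [_ _ _ _ gx].
  case: (cid _) => /= bg' [_ _ _ _ gx'].
  have [u ->] := gx x; have [u' ->] := gx' y.
  apply: (dis (pos i) (pos i')).
  by move=> [] /place_inj.
- move: TY; rewrite /g; case: (cid _) => /= bg [_ _ _ gf _] TY.
  have [|U UY ->] := (gf (projT2 bg @: T)%SET).1; first by exists T.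
  exact: (fT (pos i)).
- case/Tf => [|[[l ls] [T TY ->]]]; [by left|right].
  have [i pi] := place_surj (eq_ind _ (fun z => l < z)%N ls _ (size_map _ _)).
  subst l; exists i; rewrite /g; case: (cid _) => /= bg [_ _ _ gf _].
  by apply/gf; exists T.
Qed.

Lemma Delta_fold : homotopy_equivalent R (realization R (Delta K n t k))
  (realization R (cx W)).
Proof.
case nE : n => [|m]; first by move: hn; rewrite nE.
have km : (k * t + t < m.+1)%N by move: hn; rewrite nE; lia.
have hp : [set ord_max]%SET \in faces (pack_complex t m.+1 k) by apply: pack_complex_base; lia.
have [f [fi fP fD]] := Delta_embeds K m.+1 t_gt0 k.
have hD : [set (f ord_max)]%SET \in faces (Delta K m.+1 t k).
  by rewrite -imset_set1; exact: fP.
have [d _] := (decomposition K t_gt0 (m.+1 + k).+1).2 m k (ltnSn _) km hp.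
have WE : W = fold_att one_point
    [seq piece K t 0 (drop_susp x) | x <- dec t (m.+1 + k).+1 (m.+1, k)].
  by rewrite /W /cs /s nE.
rewrite WE; apply: (@pequiv_realization R (PCx hD)).
apply: pe_trans d; apply: pe_sym.
exact: (@pequiv_eq _ _ f).
Qed.

Lemma Delta_wedge : homotopy_equivalent R (realization R (Delta K n t k))
  (wedge_sum (summand_base R K hn)).
Proof.
apply: homotopy_equivalent_trans Delta_fold _.
apply: (@bouquet_equivalent R W (windex n k t) _ b g (summand_base R K hn)).
- exact: windex_finite.
- exact: windex_bouquet.
- by move=> i; rewrite /b; case: (cid _) => /= bg [].
Qed.

End Final.

Theorem theorem3p7 (R : realType) (K : fieldType) (n k t : nat)
    (ht : (1 <= t)%N) (hn : (t < n - k * t)%N) :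
  homotopy_equivalent R
    (realization R (Delta K n t k))
    (wedge_sum (summand_base R K hn)).
Proof. exact: Delta_wedge. Qed.
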